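(* Let $d\ge 3$. With $\Phi_d(\beta)=\lim_{n\to\infty}\frac1n\mathbb{E}[\log Z_{\mathbb{G}(n,d),\beta}]$, \[\lim_{\beta\to\infty}\beta^{-1}\Phi_d(\beta)\le \inf_{0<\alpha\le 1/2,\ 0<z<1}F_d(\alpha,z),\] where \[F_d(\alpha,z)=-\frac{\log(\zeta\mathcal{A}^d\xi)}{\log z}+\frac{d\log(1-2\alpha^2+2\alpha^2 z)}{2\log z},\qquad \mathcal{A}=(1-2\alpha)I+2\alpha\sqrt z\,\mathcal{M},\] $I$ is the $(d+1)\times(d+1)$ identity matrix, $\zeta=(1,0,0,\dots,0)\in\mathbb{R}^{1\times(d+1)}$, $\xi=(1,z^{-1/2},z^{-1},z^{-3/2},\dots,z^{-d/2})^T\in\mathbb{R}^{(d+1)\times1}$, and $\mathcal{M}$ is the $(d+1)\times(d+1)$ matrix with rows and columns indexed by $0,\dots,d$ given by $\mathcal{M}_{0,1}=1$, $\mathcal{M}_{d,d-1}=1$, $\mathcal{M}_{i,i-1}=\mathcal{M}_{i,i+1}=1/2$ for $1\le i\le d-1$, and all other entries $0$.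
   Context: $\mathbb{G}(n,d)$ is a uniformly random simple $d$-regular graph on $n$ vertices ($dn$ even). For a graph $G=(V,E)$, $\mathcal{H}_G(\sigma)=\sum_{\{v,w\}\in E}\frac{1+\sigma_v\sigma_w}{2}$ for $\sigma\in\{\pm1\}^V$ and $Z_{G,\beta}=\sum_{\tau\in\{\pm1\}^V}\exp(-\beta\mathcal{H}_G(\tau))$. The limit defining $\Phi_d(\beta)$ exists for all $d\ge3$, $\beta>0$. *)

(* Defs.v *)
From HB Require Import structures.
From mathcomp Require Import all_boot all_order all_algebra.
From mathcomp Require Import all_classical all_reals all_analysis.
Set Implicit Arguments. Unset Strict Implicit. Unset Printing Implicit Defensive.
Import Order.TTheory GRing.Theory Num.Theory.
Import numFieldNormedType.Exports.
Local Open Scope ring_scope.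

Definition is_simple_graph (n : nat) (E : {set {set 'I_n}}) : bool :=
  [forall e in E, #|e| == 2%N].

Definition is_regular (n d : nat) (E : {set {set 'I_n}}) : bool :=
  [forall v : 'I_n, #|[set e in E | v \in e]| == d].

(* The (finite) set of simple d-regular graphs on n labelled vertices;
   G(n,d) is the uniform distribution on it. *)
Definition reg_graphs (n d : nat) : {set {set {set 'I_n}}} :=
  [set E | is_simple_graph E && is_regular d E].

Definition spin (R : realType) (b : bool) : R := if b then 1 else -1.

Definition hamiltonian (R : realType) (n : nat) (E : {set {set 'I_n}})
  (sigma : {ffun 'I_n -> bool}) : R :=
  \sum_(e in E) (1 + \prod_(v in e) spin R (sigma v)) / 2.

Definition partition_fn (R : realType) (n : nat) (E : {set {set 'I_n}})
  (beta : R) : R :=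
  \sum_(tau : {ffun 'I_n -> bool}) expR (- beta * hamiltonian R E tau).

Definition avg_free_energy (R : realType) (n d : nat) (beta : R) : R :=
  (\sum_(E in reg_graphs n d) ln (partition_fn E beta))
    / #|reg_graphs n d|%:R / n%:R.

Definition Mmat (R : realType) (d : nat) : 'M[R]_(d.+1) :=
  \matrix_(i < d.+1, j < d.+1)
    (if (i == 0%N :> nat) then (if (j == 1%N :> nat) then 1 else 0)
     else if (i == d :> nat) then (if (j == d.-1 :> nat) then 1 else 0)
     else if (j == i.-1 :> nat) || (j == i.+1 :> nat) then 1 / 2 else 0).

Definition Amat (R : realType) (d : nat) (alpha z : R) : 'M[R]_(d.+1) :=
  (1 - 2 * alpha)%:M + (2 * alpha * Num.sqrt z) *: Mmat R d.

Definition zeta_row (R : realType) (d : nat) : 'rV[R]_(d.+1) :=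
  \row_(j < d.+1) (if (j == 0%N :> nat) then 1 else 0).

Definition xi_col (R : realType) (d : nat) (z : R) : 'cV[R]_(d.+1) :=
  \col_(i < d.+1) ((Num.sqrt z)^-1 ^+ i).

Definition Fd (R : realType) (d : nat) (alpha z : R) : R :=
  - ln ((zeta_row R d *m (Amat d alpha z ^+ d) *m xi_col d z) 0 0) / ln z
  + d%:R * ln (1 - 2 * alpha ^+ 2 + 2 * alpha ^+ 2 * z) / (2 * ln z).

(* Main.v *)
(* With c = - ln z and H(s) the number of monochromatic edges, the free energy is
   - beta min H + O(n) and Jensen gives - E[min H] <= ln E[z^(min H)] / c, so it is
   enough to bound the annealed moment E[z^(min H)] in the configuration model.

   Interpolate between the graph and independent random fields on the half-edges
   (+ or - with probability alpha each, void otherwise), and let W(m, f) be the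
   moment with m random edges and f fields. If a fraction p (resp. q) of the u
   unused half-edges is frozen to + (resp. -) in all ground states, a further edge
   multiplies z^(min H) by at most 1 - (1 - z)(p^2 + q^2) and a further field by
   1 - (1 - z) alpha (p + q). As p^2 + q^2 >= 2 alpha (p + q) - 2 alpha^2,
     W(m+1, f) <= 2 W(m, f+1) - w W(m, f) + O(1/u),   w = 1 - 2 alpha^2 + 2 alpha^2 z,
   and by AM-GM g = ln W satisfies g(m+1, f) <= 2 g(m, f+1) - g(m, f) - ln w + O(1/u).
   Averaging over a window of length about sqrt n in f turns this into
   g(dn/2, 0) <= g(0, dn) - (dn/2) ln w + O(sqrt n), and g(0, dn) is explicit: the
   vertices decouple, each contributing a reflected random walk, i.e. the matrix A.

   Simple graphs have polynomially bounded density in the configuration model: the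
   mean number of bad half-edges is bounded, and switchings remove them one by one. *)

Require Import Defs.
From HB Require Import structures.
From mathcomp Require Import all_boot all_order all_algebra all_fingroup.
From mathcomp Require Import all_classical all_reals all_analysis.
From mathcomp Require Import zify ring lra.
From mathcomp Require Import fintype finset.
Set Implicit Arguments. Unset Strict Implicit. Unset Printing Implicit Defensive.
Import Order.TTheory GRing.Theory Num.Theory.
Import numFieldNormedType.Exports.

(** * Simple words in the configuration model *)

Section Words.
Variables (P V : finType) (pr : P -> P) (d : nat).
Hypothesis prK : involutive pr.
Hypothesis pr_neq : forall x, pr x != x.

(* A word lists the vertex of every half-edge, [pr] being the matching of the
   half-edges; uniform words are the configuration model. *)
Definition words : {set {ffun P -> V}} :=
  [set p : {ffun P -> V} | [forall v, #|[set x | p x == v]| == d]].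

Definition swap (p : {ffun P -> V}) (x y : P) : {ffun P -> V} :=
  [ffun t => p (tperm x y t)].

Lemma swapK x y : involutive (fun p => swap p x y).
Proof. by move=> p; apply/ffunP=> t; rewrite !ffunE tpermK. Qed.

Lemma card_word p v : p \in words -> #|[set x | p x == v]| = d.
Proof. by rewrite inE => /forallP/(_ v)/eqP. Qed.

Lemma perm_words (p : {ffun P -> V}) (s : {perm P}) :
  ([ffun t => p (s t)] \in words) = (p \in words).
Proof.
rewrite !inE; apply: eq_forallb => v; congr (_ == _).
rewrite -(card_imset _ (@perm_inj _ s)); apply: eq_card => x.
rewrite !inE; apply/imsetP/eqP => [[y]|<-].
  by rewrite inE ffunE => /eqP <- ->.
by exists ((s^-1)%g x); rewrite ?inE ?ffunE permKV ?eqxx.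
Qed.

Lemma swap_words p x y : (swap p x y \in words) = (p \in words).
Proof. exact: perm_words. Qed.

Lemma big_words_swap (T : Type) (idx : T) (op : Monoid.com_law idx) F x y :
  \big[op/idx]_(p in words) F p = \big[op/idx]_(p in words) F (swap p x y).
Proof.
rewrite (reindex_inj (inv_inj (swapK x y))) /=.
by apply: eq_bigl => p; rewrite swap_words.
Qed.

(* Loops are covered by [y = pr x], parallel edges by the other [y]. *)
Definition bad (p : {ffun P -> V}) : {set P} :=
  [set x | [exists y, [&& y != x, p y == p x & p (pr y) == p (pr x)]]].

Lemma badP (p : {ffun P -> V}) x :
  reflect (exists y, [/\ y != x, p y = p x & p (pr y) = p (pr x)]) (x \in bad p).
Proof.
rewrite inE; apply: (iffP existsP) => -[y].
  by case/and3P=> ? /eqP ? /eqP ?; exists y.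
by case=> ? ? ?; exists y; apply/and3P; split=> //; apply/eqP.
Qed.

(** The set collects the half-edges at [v] and at its neighbours: [d] at [v], and at most [d] for
    each of the [d] neighbours. *)
Lemma card_nbr p v : p \in words ->
  #|[set y | (p y == v) || [exists t, (p t == v) && (p (pr t) == p y)]]| <= d + d * d.
Proof.
move=> pW.
have -> : [set y | (p y == v) || [exists t, (p t == v) && (p (pr t) == p y)]] =
   [set y | p y == v] :|:
   \bigcup_(t in [set t | p t == v]) [set y | p y == p (pr t)].
  apply/setP=> y; rewrite !inE; congr (_ || _).
  apply/existsP/bigcupP => [[t /andP[t1 t2]]|[t]].
    by exists t; rewrite inE // eq_sym.
  by rewrite !inE => t1 t2; exists t; rewrite t1 eq_sym.
apply: (leq_trans (leq_card_setU _ _)); rewrite card_word // leq_add2l.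
rewrite -{1}(card_word v pW) -sum_nat_const.
elim/big_ind2: _ => [|m A n B hA hB|t _]; rewrite ?cards0 ?card_word //.
by apply: (leq_trans (leq_card_setU _ _)); apply: leq_add.
Qed.

(* Switching: exchanging one end of a bad edge with an end of a far-away good
   edge creates no new bad half-edge. *)
Lemma switching p x : p \in words -> x \in bad p ->
  2 * (d + d * d) + #|bad p| < #|P| ->
  exists y, #|bad (swap p (pr x) y)| < #|bad p|.
Proof.
move=> pW xbad hD.
pose A v := [set y | (p y == v) || [exists t, (p t == v) && (p (pr t) == p y)]].
(* For [y] outside [B] the vertices of [x] and [y] are neither equal nor adjacent, nor are those of
   [pr x] and [pr y], so the two new edges are no loops and duplicate no old edge. *)
pose B := A (p x) :|: pr @: A (p (pr x)) :|: bad p.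
have cB : #|B| < #|P|.
  apply: leq_ltn_trans hD; apply: (leq_trans (leq_card_setU _ _)).
  rewrite leq_add2r mul2n -addnn; apply: (leq_trans (leq_card_setU _ _)).
  apply: leq_add; first exact: card_nbr.
  by rewrite (card_imset _ (inv_inj prK)) card_nbr.
have [y yB] : exists y, y \notin B.
  apply/existsP; rewrite -negb_forall; apply: contraL cB => /forallP h.
  by rewrite -leqNgt; apply/subset_leq_card/subsetP => y _.
move: yB; rewrite !inE !negb_or -!andbA => /and4P[y1 y2 y3 /existsP y4].
have a1 t : p t = p x -> p (pr t) = p y -> False.
  move=> e1 e2; case/negP: y2; apply/existsP; exists t.
  by rewrite e1 e2 !eqxx.
have /norP[/eqP y1' /existsP y2'] : ~~ ((p (pr y) == p (pr x)) ||
     [exists t, (p t == p (pr x)) && (p (pr t) == p (pr y))]).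
  apply: contra y3 => h; apply/imsetP; exists (pr y); last by rewrite prK.
  by rewrite inE.
have a2 t : p t = p (pr x) -> p (pr t) = p (pr y) -> False.
  by move=> e1 e2; apply: y2'; exists t; rewrite e1 e2 !eqxx.
have a3 t : t != y -> p t = p y -> p (pr t) = p (pr y) -> False.
  by move=> e1 e2 e3; apply: y4; exists t; rewrite e1 e2 e3 !eqxx.
have {}y1 : p y <> p x by apply/eqP.
have yx : y != x by apply/eqP => e; apply: y1; rewrite e.
have yx' : y != pr x by apply/eqP => e; apply: (a1 x) => //; rewrite e.
have y'x' : pr y != pr x by rewrite (inj_eq (inv_inj prK)).
have y'x : pr y != x by rewrite (can2_eq prK prK).
exists y; set q := swap p (pr x) y.
have qx : q x = p x by rewrite ffunE tpermD // eq_sym // pr_neq.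
have qx' : q (pr x) = p y by rewrite ffunE tpermL.
have qy : q y = p (pr x) by rewrite ffunE tpermR.
have qy' : q (pr y) = p (pr y).
  by rewrite ffunE tpermD // eq_sym // pr_neq.
have qo t : t != pr x -> t != y -> q t = p t.
  by move=> *; rewrite ffunE tpermD // eq_sym.
(* Only the two switched edges change. Each clash involving one of them is excluded by the choice of
   [y], so a bad half-edge of [q] was already bad in [p], while [x] is bad no more. *)
have q4 t : [\/ t = x, t = pr x, t = y | t = pr y] \/
   (q t = p t /\ q (pr t) = p (pr t)).
  have [->|t1] := eqVneq t x; first by left; constructor.
  have [->|t2] := eqVneq t (pr x); first by left; constructor.
  have [->|t3] := eqVneq t y; first by left; constructor.
  have [->|t4] := eqVneq t (pr y); first by left; constructor.
  by right; rewrite !qo // ?(inj_eq (inv_inj prK)) // (can2_eq prK prK).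
have sub : bad q \subset bad p :\ x.
  apply/subsetP => t /badP[s [st e1 e2]].
  have key : t <> x /\ (q t = p t /\ q (pr t) = p (pr t)) /\
             (q s = p s /\ q (pr s) = p (pr s)).
    have ya : p y = p (pr y) -> False.
      by move=> h; apply: (a3 (pr y)); rewrite ?pr_neq ?prK.
    have yb : p y = p (pr x) -> False by move=> h; apply: (a1 x).
    case: (q4 t) (q4 s) => [ht|[t1 t2]] [hs|[s1 s2]].
    - exfalso; move: e1 e2 st.
      by case: ht => ->; case: hs => ->; rewrite ?prK ?eqxx // ?qx ?qx' ?qy ?qy' //;
        move=> *; first [apply: y1; congruence | apply: y1'; congruence
           | apply: ya; congruence | apply: yb; congruence ].
    - exfalso; move: e1 e2; rewrite s1 s2.
      case: ht => ->; rewrite ?prK ?qx ?qx' ?qy ?qy' => e1 e2.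
      + exact: a1 e1 e2.
      + by apply: (a1 (pr s)); rewrite ?prK.
      + exact: a2 e1 e2.
      + by apply: (a2 (pr s)); rewrite ?prK.
    - exfalso; move: e1 e2; rewrite t1 t2.
      case: hs => ->; rewrite ?prK ?qx ?qx' ?qy ?qy' => e1 e2.
      + exact: a1 (esym e1) (esym e2).
      + by apply: (a1 (pr t)); rewrite ?prK.
      + exact: a2 (esym e1) (esym e2).
      + by apply: (a2 (pr t)); rewrite ?prK.
    - split=> // tx; rewrite tx in t2; rewrite qx' in t2.
      exact: yb t2.
  case: key => tx [[t1 t2] [s1 s2]]; rewrite in_setD1; apply/andP; split.
    exact/eqP.
  by apply/badP; exists s; split=> //; congruence.
by apply: (leq_ltn_trans (subset_leq_card sub)); rewrite [X in _ < X](cardsD1 x) xbad.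
Qed.

(** * Density of the simple words *)

Definition words_le k := [set p in words | #|bad p| <= k].

Lemma words_leE k (p : {ffun P -> V}) :
  (p \in words_le k) = (p \in words) && (#|bad p| <= k).
Proof. by rewrite [LHS]in_set. Qed.

(** A switching is undone by the same swap, so a word with [k.+1] bad half-edges is recovered from
    one with at most [k] and the two swapped half-edges; hence the factor [#|P| ^ 2]. *)
Lemma words_le_step k : 2 * (d + d * d) + k.+1 < #|P| ->
  #|words_le k.+1| <= (#|P| ^ 2).+1 * #|words_le k|.
Proof.
move=> hD.
pose f (t : {ffun P -> V} * P * P) := swap t.1.1 t.1.2 t.2.
have sub : words_le k.+1 \subset words_le k :|:
    f @: (setX (setX (words_le k) [set: P]) [set: P]).
  apply/subsetP => p; rewrite in_setU !words_leE => /andP[pW]; rewrite leq_eqVlt ltnS pW /=.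
  case/predU1P => [bk|->//]; apply/orP; right.
  have [x xbad] : exists x, x \in bad p by apply/set0Pn; rewrite -card_gt0 bk.
  have [|y hy] := switching pW xbad; first by rewrite bk.
  apply/imsetP; exists (swap p (pr x) y, pr x, y); last by rewrite /f /= swapK.
  by rewrite in_setX in_setX !in_setT !andbT words_leE swap_words pW /= -ltnS -bk.
apply: (leq_trans (subset_leq_card sub)).
apply: (leq_trans (leq_card_setU _ _)).
rewrite mulSn leq_add2l; apply: (leq_trans (leq_imset_card _ _)).
by rewrite !cardsX !cardsT [X in _ <= X]mulnC -(mulnn #|P|) [X in _ <= X]mulnA leqnn.
Qed.

Lemma words_le_simple k : 2 * (d + d * d) + k < #|P| ->
  #|words_le k| <= (#|P| ^ 2).+1 ^ k * #|words_le 0|.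
Proof.
elim: k => [|k IH] hk; first by rewrite mul1n.
apply: (leq_trans (words_le_step hk)); rewrite [X in _ <= X * _]expnS -mulnA leq_mul2l.
by rewrite IH ?orbT //; apply: leq_trans hk; rewrite ltnS leq_add2l.
Qed.

(** Swapping [pr x] with [t] preserves the sum and turns a coincidence at [pr x] into one at [t],
    which holds for at most [d] choices of [t]. Summing over [t] in [T] gains a factor of about
    [d / #|P|]. For a loop, [y = pr x], the two conditions are the same one. *)
Lemma sum_parallel x y : y != x ->
  (#|P| - 3) * \sum_(p in words) ((p y == p x) && (p (pr y) == p (pr x)))
  <= if y == pr x then d * #|words| else d * \sum_(p in words) (p y == p x).
Proof.
move=> yx.
pose T := [set t : P | [&& t != x, t != y & t != pr y]].
have cT : #|P| - 3 <= #|T|.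
  have -> : T = [set: P] :\ x :\ y :\ (pr y).
    by apply/setP => t; rewrite !inE andbT; case: (t == x); case: (t == y); case: (t == pr y).
  rewrite leq_subLR -cardsT (cardsD1 x) (cardsD1 y ([set: P] :\ x)).
  rewrite (cardsD1 (pr y) ([set: P] :\ x :\ y)).
  by do !case: (_ \in _); rewrite /=; lia.
apply: (@leq_trans (\sum_(t in T) \sum_(p in words)
          ((p y == p x) && (p (pr y) == p (pr x))))).
  by rewrite sum_nat_const leq_mul2r cT orbT.
have [e|yx'] := eqVneq y (pr x).
  subst y; rewrite prK in cT *.
  apply: (@leq_trans (\sum_(t in T) \sum_(p in words) (p t == p x))).
    apply: leq_sum => t; rewrite !inE prK => /and3P[tx ty _].
    rewrite (big_words_swap _ _ (pr x) t); apply: leq_sum => p _.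
    rewrite !ffunE tpermL tpermD // ?pr_neq //.
    by rewrite (eq_sym (p x)) andbb.
  rewrite exchange_big /= mulnC -sum_nat_const; apply: leq_sum => p pW.
  rewrite -big_mkcondr sum1dep_card -(card_word (p x) pW).
  by apply/subset_leq_card/subsetP => t; rewrite !inE => /andP[].
apply: (@leq_trans (\sum_(t in T) \sum_(p in words)
          ((p y == p x) && (p (pr y) == p t)))).
  apply: leq_sum => t; rewrite !inE => /and3P[tx ty ty'].
  rewrite (big_words_swap _ _ (pr x) t); apply: leq_sum => p _.
  rewrite !ffunE tpermL (@tpermD _ _ _ x) ?pr_neq // (@tpermD _ _ _ y) //;
    last by rewrite eq_sym.
  by rewrite (@tpermD _ _ _ (pr y)) // (inj_eq (inv_inj prK)) eq_sym.
rewrite exchange_big /= big_distrr; apply: leq_sum => p pW.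
rewrite (eq_bigr (fun t : P => (p y == p x) * (p (pr y) == p t))); last first.
  by move=> t _; rewrite mulnb.
rewrite -big_distrr /= mulnC leq_mul2r -big_mkcondr sum1dep_card; apply/orP; right.
rewrite -(card_word (p (pr y)) pW).
by apply/subset_leq_card/subsetP => t; rewrite !inE (eq_sym (p t)) => /andP[].
Qed.

(** Union bound over the [y] that make [x] bad: the loop contributes [d], and every other [y]
    contributes [d] when it lies at the vertex of [x], which at most [d] of them do. *)
Lemma sum_bad : (#|P| - 3) * \sum_(p in words) #|bad p| <= #|P| * ((d + d * d) * #|words|).
Proof.
have hb p : #|bad p| <=
    \sum_(x : P) \sum_(y | y != x) ((p y == p x) && (p (pr y) == p (pr x))).
  rewrite -sum1_card big_mkcond; apply: leq_sum => x _.
  case: ifP => // /badP[y [yx e1 e2]].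
  by rewrite (bigD1 y) //= e1 e2 !eqxx.
apply: (@leq_trans ((#|P| - 3) * \sum_(x : P) \sum_(y | y != x) \sum_(p in words)
     ((p y == p x) && (p (pr y) == p (pr x))))).
  rewrite leq_mul2l; apply/orP; right.
  apply: (leq_trans (leq_sum _ (fun p _ => hb p))).
  rewrite exchange_big /=; apply: leq_sum => x _.
  by rewrite exchange_big.
rewrite big_distrr -[X in _ <= X * _]sum1_card big_distrl /=.
apply: leq_sum => x _; rewrite mul1n big_distrr /= (bigD1 (pr x)) ?pr_neq //= mulnDl.
apply: leq_add.
  by apply: (leq_trans (sum_parallel (pr_neq x))); rewrite eqxx.
apply: (@leq_trans (\sum_(y | (y != x) && (y != pr x)) d * \sum_(p in words) (p y == p x))).
  apply: leq_sum => y /andP[yx yx'].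
  by apply: (leq_trans (sum_parallel yx)); rewrite (negbTE yx').
rewrite -big_distrr /= -mulnA leq_mul2l exchange_big /=; apply/orP; right.
rewrite mulnC -sum_nat_const; apply: leq_sum => p pW.
rewrite -big_mkcondr sum1dep_card -(card_word (p x) pW).
by apply/subset_leq_card/subsetP => t; rewrite !inE => /andP[].
Qed.

Definition simple_words := [set p in words | bad p == set0].

(** A bound for the mean number of bad half-edges: the factor 2 absorbs [#|P| / (#|P| - 3)] once
    [#|P|] exceeds 5. *)
Let K := 2 * (d + d * d).

(** By Markov's inequality at least one word in [K.+1] has at most [K] bad half-edges, and [K]
    rounds of switching compare these words with the simple ones at polynomial cost. *)
Lemma card_words_simple : 2 * K < #|P| -> 5 < #|P| ->
  #|words| <= K.+1 * ((#|P| ^ 2).+1 ^ K * #|simple_words|).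
Proof.
move=> hP hP5.
have sb : \sum_(p in words) #|bad p| <= K * #|words|.
  have := sum_bad; rewrite /K; move: (\sum_(p in words) _) (#|words|) => S W h.
  have h2 : (#|P| - 3) * S <= (#|P| - 3) * (2 * (d + d * d) * W).
    apply: (leq_trans h); rewrite -mulnA [X in _ <= X]mulnA leq_mul2r; lia.
  by move: h2; rewrite leq_mul2l => /orP[|//]; lia.
have -> : simple_words = words_le 0.
  by apply/setP => p; rewrite !inE leqn0 cards_eq0.
have hw : #|words| <= K.+1 * #|words_le K|; last first.
  apply: (leq_trans hw); rewrite leq_mul2l words_le_simple //; last by move: hP; rewrite /K; lia.
have h3 : \sum_(p in words) K.+1 * (K < #|bad p|) <= \sum_(p in words) #|bad p|.
  by apply: leq_sum => p _; case: ltnP; rewrite ?muln1 ?muln0.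
have h4 : \sum_(p in words) (K < #|bad p|) + #|words_le K| = #|words|.
  rewrite -!sum1_card [X in _ + X](eq_bigl (fun p => (p \in words) && (#|bad p| <= K))).
    rewrite [X in _ + X]big_mkcondr -big_split /=; apply: eq_bigr => p _.
    by case: leqP.
  by move=> p; rewrite !inE.
have arith k l w s b : k.+1 * s <= b -> b <= k * w -> s + l = w -> w <= k.+1 * l by nia.
by rewrite -big_distrr /= in h3; exact: arith h3 sb h4.
Qed.

(** * Graphs of simple words *)

Definition graph (p : {ffun P -> V}) : {set {set V}} :=
  [set [set p x; p (pr x)] | x : P].

Lemma simpleP (p : {ffun P -> V}) :
  reflect (p \in words /\ forall x y, p y = p x -> p (pr y) = p (pr x) -> y = x)
          (p \in simple_words).
Proof.
rewrite [_ \in simple_words]in_set; apply: (iffP andP) => -[pW h]; split=> //.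
  move=> x y e1 e2; apply/eqP; apply: contraTT h => yx; apply/set0Pn; exists x.
  by apply/badP; exists y.
apply/eqP/setP => x; rewrite in_set0; apply/negP => /badP[y [yx e1 e2]].
by rewrite (h _ _ e1 e2) eqxx in yx.
Qed.

Lemma simple_loop (p : {ffun P -> V}) x : p \in simple_words -> p (pr x) != p x.
Proof.
case/simpleP => _ inj; apply/eqP => e; have := pr_neq x.
by rewrite (inj x (pr x)) ?eqxx // prK e.
Qed.

Lemma set2_inj (T : finType) (a b c e : T) : [set a; b] = [set c; e] ->
  (a = c /\ b = e) \/ (a = e /\ b = c).
Proof.
move=> h; have {}h x : x \in [set a; b] = (x \in [set c; e]) by rewrite h.
move: (h a) (h b) (h c) (h e); rewrite !inE !eqxx ?orbT /=.
move=> /esym/orP[]/eqP ? /esym/orP[]/eqP ? /orP[]/eqP ? /orP[]/eqP ?; subst; auto.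
Qed.

(* The permutations of the half-edges that respect the matching act simply
   transitively on the simple words with a given graph. *)
Definition pr_perms : {set {perm P}} := [set s : {perm P} | [forall x, s (pr x) == pr (s x)]].

Lemma card_fiber (p0 : {ffun P -> V}) : p0 \in simple_words ->
  #|[set p in simple_words | graph p == graph p0]| = #|pr_perms|.
Proof.
move=> p0S; have /simpleP[p0W inj0] := p0S.
rewrite -(@card_in_imset _ _ (fun s : {perm P} => [ffun t => p0 (s t)]) (mem pr_perms)); last first.
  move=> s s'; rewrite !inE => /forallP hs /forallP hs' /ffunP e.
  apply/permP => x; apply: inj0; first by have := e x; rewrite !ffunE.
  by have := e (pr x); rewrite !ffunE (eqP (hs x)) (eqP (hs' x)).
apply: eq_card => p; apply/idP/imsetP => [|[s]].
  rewrite [_ \in finset _]in_set => /andP[/simpleP[pW inj] /eqP gp].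
  have ex x : exists y, (p0 y == p x) && (p0 (pr y) == p (pr x)).
    have : [set p x; p (pr x)] \in graph p by apply/imsetP; exists x.
    rewrite gp => /imsetP[y _ /set2_inj[[-> ->]|[-> ->]]].
      by exists y; rewrite !eqxx.
    by exists (pr y); rewrite prK !eqxx.
  (* The half-edge that carries in [p0] the same edge, seen from the same end, as [x] does in [p];
     simplicity of [p0] makes it unique. *)
  pose f x := xchoose (ex x).
  have f1 x : p0 (f x) = p x by have /andP[/eqP] := xchooseP (ex x).
  have f2 x : p0 (pr (f x)) = p (pr x) by have /andP[_ /eqP] := xchooseP (ex x).
  have finj : injective f.
    by move=> x y e; apply: inj; [rewrite -!f1 e | rewrite -!f2 e].
  exists (perm finj).
    rewrite inE; apply/forallP => x; rewrite !permE; apply/eqP.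
    by apply: inj0; rewrite ?f1 // prK f1 f2 prK.
  by apply/ffunP => x; rewrite ffunE permE f1.
move=> sS ->; have hs x : s (pr x) = pr (s x).
  by move: sS; rewrite !inE => /forallP/(_ x)/eqP.
rewrite [_ \in finset _]in_set; apply/andP; split.
  apply/simpleP; split; first by rewrite perm_words.
  move=> x y; rewrite !ffunE hs hs => e1 e2.
  by apply: (@perm_inj _ s); apply: inj0.
apply/eqP/setP => e; apply/imsetP/imsetP => -[x _ ->].
  by exists (s x); rewrite // !ffunE hs.
by exists ((s^-1)%g x); rewrite // !ffunE hs permKV.
Qed.

Lemma graph_simple (p : {ffun P -> V}) (e : {set V}) :
  p \in simple_words -> e \in graph p -> #|e| = 2.
Proof.
by move=> pS /imsetP[x _ ->]; rewrite cards2 eq_sym simple_loop.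
Qed.

Lemma graph_degree (p : {ffun P -> V}) v :
  p \in simple_words -> #|[set e in graph p | v \in e]| = d.
Proof.
move=> pS; have /simpleP[pW inj] := pS.
rewrite -(card_word v pW) -(@card_in_imset _ _ (fun x => [set p x; p (pr x)]) (mem [set x | p x == v])).
  apply: eq_card => e; rewrite inE; apply/andP/imsetP => [[/imsetP[x _ ->]]|[x]].
    rewrite !inE => /orP[/eqP->|/eqP->]; first by exists x; rewrite ?inE.
    by exists (pr x); rewrite ?inE // prK setUC.
  by rewrite inE => /eqP <- ->; rewrite !inE eqxx; split=> //; apply/imsetP; exists x.
move=> x y; rewrite !inE => /eqP px /eqP py /set2_inj[[e1 e2]|[e1 e2]].
  exact: inj.
by have := simple_loop x pS; rewrite e2 py px eqxx.
Qed.

End Words.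

(** * The interpolation inequality *)

Section Ground.
Variable V : finType.
Implicit Types (h : {ffun V -> bool} -> nat) (a b : V) (s : bool).

Definition ground h := h [arg min_(s < [ffun=> true]) h s].

Lemma ground_le h c : ground h <= h c.
Proof. by rewrite /ground; case: arg_minnP => // i _; apply. Qed.

Lemma ground_ex h : exists c, h c = ground h.
Proof. by eexists. Qed.

Lemma le_ground h m : (forall c, m <= h c) -> m <= ground h.
Proof. by move=> le; have [c <-] := ground_ex h. Qed.

Definition add_field h a s := fun c => h c + (c a == s).
Definition add_edge h a b := fun c => h c + (c a == c b).

Lemma add_fieldC h a s a' s' :
  add_field (add_field h a s) a' s' = add_field (add_field h a' s') a s.
Proof. by apply/funext => c; rewrite /add_field addnAC. Qed.

Lemma add_field_edge h a s a' b' :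
  add_field (add_edge h a' b') a s = add_edge (add_field h a s) a' b'.
Proof. by apply/funext => c; rewrite /add_field /add_edge addnAC. Qed.

Definition frozen h a s := [forall c, (h c == ground h) ==> (c a == s)].

Lemma frozenP h a s c : frozen h a s -> h c = ground h -> c a = s.
Proof. by move=> /forallP/(_ c) /implyP fr /eqP /fr /eqP. Qed.

Lemma frozen_excl h a : ~~ (frozen h a true && frozen h a false).
Proof.
have [c hc] := ground_ex h; apply/negP => /andP[f1 f2].
by have := frozenP f1 hc; rewrite (frozenP f2 hc).
Qed.

(** Energies are integers: a configuration that is not a ground state already costs [ground h + 1],
    so the minimum rises exactly when every ground state pays for the field. *)
Lemma ground_field h a s : ground (add_field h a s) = ground h + frozen h a s.
Proof.
apply/eqP; rewrite eqn_leq; apply/andP; split.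
  have [fr|] := boolP (frozen h a s).
    have [c hc] := ground_ex h; apply: leq_trans (ground_le _ c) _.
    by rewrite /add_field hc leq_add2l leq_b1.
  rewrite negb_forall => /existsP[c]; rewrite negb_imply => /andP[/eqP hc ca].
  by apply: leq_trans (ground_le _ c) _; rewrite /add_field hc (negbTE ca).
apply: le_ground => c; rewrite /add_field.
have [fr|_] := boolP (frozen h a s); last by rewrite addn0 (leq_trans (ground_le h c)) ?leq_addr.
have := ground_le h c; rewrite leq_eqVlt => /predU1P[hc|]; last by lia.
by rewrite (frozenP fr (esym hc)) eqxx hc.
Qed.

Lemma ground_edge h a b s : frozen h a s -> frozen h b s ->
  ground h < ground (add_edge h a b).
Proof.
move=> fa fb; apply: le_ground => c; rewrite /add_edge.
have := ground_le h c; rewrite leq_eqVlt => /predU1P[hc|]; last by lia.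
by rewrite (frozenP fa (esym hc)) (frozenP fb (esym hc)) eqxx hc addn1.
Qed.

Lemma ground_edge_ge h a b : ground h <= ground (add_edge h a b).
Proof. by apply: le_ground => c; rewrite /add_edge (leq_trans (ground_le h c)) ?leq_addr. Qed.

End Ground.

Local Open Scope ring_scope.

Section Interpolation.
Variables (R : realFieldType) (P V : finType) (d : nat) (al z : R).
Hypotheses (al_gt0 : 0 < al) (al_le : al <= 1 / 2) (z_gt0 : 0 < z) (z_lt1 : z < 1).
Implicit Types (h : {ffun V -> bool} -> nat) (l : seq V).

(* Expected value of z^(ground energy) when every site in [l] receives an
   independent field, equal to either sign with probability [al] and void
   otherwise. *)
Fixpoint field_avg l h : R :=
  if l is a :: l' then (1 - 2 * al) * field_avg l' h +
     al * (field_avg l' (add_field h a true) + field_avg l' (add_field h a false))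
  else z ^+ ground h.

Lemma mix_le x y t x' y' t' : x <= x' -> y <= y' -> t <= t' ->
  (1 - 2 * al) * x + al * (y + t) <= (1 - 2 * al) * x' + al * (y' + t').
Proof.
move=> hx hy ht; apply: lerD; first by rewrite ler_wpM2l //; move: al_le; lra.
by rewrite ler_wpM2l ?lerD // ltW.
Qed.

Lemma field_avg_gt0 l h : 0 < field_avg l h.
Proof.
elim: l h => [|a l IH] h /=; first exact: exprn_gt0.
rewrite ltr_wpDl //; last by rewrite mulr_gt0 ?addr_gt0.
by apply: mulr_ge0 (ltW (IH h)); move: al_le; lra.
Qed.

Lemma field_avg_swap a b l h : field_avg [:: a, b & l] h = field_avg [:: b, a & l] h.
Proof.
rewrite /= !(add_fieldC _ b _ a); ring.
Qed.

Lemma field_avg_field a s l h :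
  z * field_avg l h <= field_avg l (add_field h a s) <= field_avg l h.
Proof.
elim: l h => [|b l IH] h.
  have zF : z * z ^+ ground h <= z ^+ ground h by rewrite ger_pMl ?exprn_gt0 // ltW.
  by rewrite /= ground_field; case: frozen; rewrite ?addn0 ?addn1 ?exprS ?zF lexx.
have /andP[a1 b1] := IH h; have /andP[a2 b2] := IH (add_field h b true).
have /andP[a3 b3] := IH (add_field h b false).
rewrite /= !(add_fieldC _ a _ b) mix_le // andbT.
have -> : z * ((1 - 2 * al) * field_avg l h + al * (field_avg l (add_field h b true)
    + field_avg l (add_field h b false))) = (1 - 2 * al) * (z * field_avg l h)
   + al * (z * field_avg l (add_field h b true) + z * field_avg l (add_field h b false)).
  by ring.
exact: mix_le.
Qed.

Lemma field_avg_cons a l h :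
  z * field_avg l h <= field_avg (a :: l) h <= field_avg l h.
Proof.
have /andP[a1 b1] := field_avg_field a true l h.
have /andP[a2 b2] := field_avg_field a false l h.
have zF : z * field_avg l h <= field_avg l h by rewrite ger_pMl ?field_avg_gt0 // ltW.
have e x : x = (1 - 2 * al) * x + al * (x + x) by ring.
apply/andP; split; first by rewrite [X in X <= _]e mix_le.
by rewrite [X in _ <= X]e mix_le.
Qed.

Lemma field_avg_edge a b l h : field_avg l (add_edge h a b) <= field_avg l h.
Proof.
elim: l h => [|c l IH] h /=.
  by apply: ler_wiXn2l; rewrite ?ltW // ground_edge_ge.
rewrite !add_field_edge.
exact: mix_le.
Qed.

Definition edge_weight : R := 1 - 2 * al ^+ 2 + 2 * al ^+ 2 * z.

Lemma sum_const_seq (U : seq V) (c : R) : \sum_(x <- U) c = c * (size U)%:R.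
Proof. by rewrite big_const_seq count_predT iter_addr addr0 mulr_natr. Qed.

Lemma sum_mul_sum (U : seq V) (f g : V -> R) :
  \sum_(x <- U) \sum_(y <- U) f x * g y = (\sum_(x <- U) f x) * \sum_(y <- U) g y.
Proof. by rewrite big_distrl; apply: eq_bigr => x _; rewrite big_distrr. Qed.

(* The interpolation inequality: with p, q the fractions of sites frozen to
   either sign, it amounts to p^2 + q^2 >= 2 al (p + q) - 2 al^2. *)
Lemma edge_le_fields (U : seq V) l h :
  \sum_(x <- U) \sum_(y <- U) field_avg l (add_edge h x y) <=
  2 * (size U)%:R * \sum_(x <- U) field_avg (x :: l) h
    - (size U)%:R ^+ 2 * edge_weight * field_avg l h.
Proof.
set u := (size U)%:R : R.
(* The inequality is linear in the averages: with one more field it is the mixture, with weights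
   [1 - 2 * al], [al] and [al], of three instances of the induction hypothesis. *)
elim: l h => [|a l IH] h; last first.
  have := IH h; have := IH (add_field h a true); have := IH (add_field h a false).
  have e1 : \sum_(x <- U) \sum_(y <- U) field_avg (a :: l) (add_edge h x y) =
    (1 - 2 * al) * (\sum_(x <- U) \sum_(y <- U) field_avg l (add_edge h x y)) +
    al * (\sum_(x <- U) \sum_(y <- U) field_avg l (add_edge (add_field h a true) x y)
     + \sum_(x <- U) \sum_(y <- U) field_avg l (add_edge (add_field h a false) x y)).
    rewrite -big_split /= !mulr_sumr -big_split; apply: eq_bigr => x _ /=.
    rewrite -big_split /= !mulr_sumr -big_split; apply: eq_bigr => y _ /=.
    by rewrite !add_field_edge.
  have e2 : \sum_(x <- U) field_avg [:: x, a & l] h =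
    (1 - 2 * al) * (\sum_(x <- U) field_avg (x :: l) h) +
    al * (\sum_(x <- U) field_avg (x :: l) (add_field h a true)
     + \sum_(x <- U) field_avg (x :: l) (add_field h a false)).
    rewrite -big_split /= !mulr_sumr -big_split; apply: eq_bigr => x _.
    by rewrite [LHS]field_avg_swap.
  rewrite e1 e2 [field_avg (a :: l) h]/=.
  move: (\sum_(x <- U) \sum_(y <- U) _) (\sum_(x <- U) \sum_(y <- U) _)
    (\sum_(x <- U) \sum_(y <- U) _) => s1 s2 s3.
  move: (\sum_(x <- U) _) (\sum_(x <- U) _) (\sum_(x <- U) _) => t1 t2 t3.
  move: (field_avg _ _) (field_avg _ _) (field_avg _ _) => f1 f2 f3 h3 h2 h1.
  have c0 : 0 <= 1 - 2 * al by move: al_le; lra.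
  have al0 := ltW al_gt0.
have := ler_wpM2l c0 h1; have := ler_wpM2l al0 h2; have := ler_wpM2l al0 h3.
  by lra.
pose t x : R := (frozen h x true)%:R; pose f x : R := (frozen h x false)%:R.
set F := z ^+ ground h.
have F0 : 0 < F by exact: exprn_gt0.
have le1 : \sum_(x <- U) \sum_(y <- U) field_avg [::] (add_edge h x y) <=
    \sum_(x <- U) \sum_(y <- U) (F - F * (1 - z) * (t x * t y + f x * f y)).
  apply: ler_sum => x _; apply: ler_sum => y _ /=; rewrite /t /f.
  have z0 : 0 <= z <= 1 by rewrite !ltW.
  have base : z ^+ ground (add_edge h x y) <= F.
    by apply: ler_wiXn2l; rewrite ?ltW // ground_edge_ge.
  have strict s : frozen h x s -> frozen h y s -> z ^+ ground (add_edge h x y) <= F * z.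
    move=> fx fy; rewrite /F -exprSr; apply: ler_wiXn2l; rewrite ?ltW //.
    exact: ground_edge fx fy.
  have := frozen_excl h x; have := frozen_excl h y.
  case ft : (frozen h x true); case gt : (frozen h y true);
  case ff : (frozen h x false); case gf : (frozen h y false) => // _ _;
  rewrite ?(mulr0, mul0r, mulr1, addr0, add0r, subr0) //;
  by rewrite mulrBr mulr1 opprB addrC subrK; apply: strict; eassumption.
apply: (le_trans le1).
have -> : \sum_(x <- U) \sum_(y <- U) (F - F * (1 - z) * (t x * t y + f x * f y)) =
  F * u ^+ 2 - F * (1 - z) * ((\sum_(x <- U) t x) ^+ 2 + (\sum_(x <- U) f x) ^+ 2).
  under eq_bigr do rewrite sumrB -mulr_sumr big_split /=.
  rewrite sumrB -mulr_sumr big_split /= !sum_mul_sum !expr2.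
  by rewrite !sum_const_seq -/u (mulrA F).
have -> : \sum_(x <- U) field_avg [:: x] h =
   F * u - F * (1 - z) * al * ((\sum_(x <- U) t x) + (\sum_(x <- U) f x)).
  transitivity (\sum_(x <- U) (F - F * (1 - z) * al * (t x + f x))).
    apply: eq_bigr => x _; rewrite /= !ground_field !exprD -/F /t /f.
    have := frozen_excl h x.
    by case: (frozen h x true); case: (frozen h x false) => // _;
       rewrite /= ?expr0 ?expr1; ring.
  rewrite sumrB -mulr_sumr big_split /=.
  by rewrite sum_const_seq.
rewrite /= -/F /edge_weight.
move: (\sum_(x <- U) t x) (\sum_(x <- U) f x) => p q.
rewrite -subr_ge0.
set X := (X in 0 <= X).
(* Here [p] and [q] are numbers of frozen sites. The gap vanishes when a fraction [al] of the sites
   is frozen to each sign. *)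
have -> : X = F * (1 - z) * ((p - al * u) ^+ 2 + (q - al * u) ^+ 2).
  by rewrite /X; ring.
apply: mulr_ge0; first by rewrite mulr_ge0 ?subr_ge0 ?ltW.
by rewrite addr_ge0 ?sqr_ge0.
Qed.

(** * Interpolating moments in the configuration model *)

Fixpoint edge_energy (p : {ffun P -> V}) (es : seq (P * P)) : {ffun V -> bool} -> nat :=
  if es is e :: es' then add_edge (edge_energy p es') (p e.1) (p e.2) else fun=> 0%N.

(** The half-edges in [fs] carry fields, and those outside [es] and [fs] are idle. This is a sum and
    not a mean over words; the number of words is divided out at the end. *)
Definition interp (es : seq (P * P)) (fs : seq P) : R :=
  \sum_(p in words P V d) field_avg (map p fs) (edge_energy p es).

Lemma interp_field es fs x : z * interp es fs <= interp es (x :: fs) <= interp es fs.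
Proof.
by rewrite /interp mulr_sumr; apply/andP; split; apply: ler_sum => p _;
  have /andP[] := field_avg_cons (p x) (map p fs) (edge_energy p es).
Qed.

Lemma interp_edge es fs e : interp (e :: es) fs <= interp es fs.
Proof. by apply: ler_sum => p _; apply: field_avg_edge. Qed.

Lemma interp_gt0 es fs : (0 < #|words P V d|)%N -> 0 < interp es fs.
Proof.
move=> /card_gt0P[p pW]; rewrite /interp (bigD1 p) //=.
by rewrite ltr_wpDr ?field_avg_gt0 // sumr_ge0 // => q _; rewrite ltW ?field_avg_gt0.
Qed.

Definition ends (es : seq (P * P)) := map fst es ++ map snd es.

Lemma swap_energy (p : {ffun P -> V}) x y es : x \notin ends es -> y \notin ends es ->
  edge_energy (swap p x y) es = edge_energy p es.
Proof.
rewrite !mem_cat !negb_or.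
elim: es => //= -[a b] es IH; rewrite !inE !negb_or /=.
move=> /andP[/andP[xa xe] /andP[xb xe']] /andP[/andP[ya ye] /andP[yb ye']].
by rewrite IH ?xe ?ye // !ffunE !tpermD.
Qed.

Lemma swap_fields (p : {ffun P -> V}) x y (fs : seq P) : x \notin fs -> y \notin fs ->
  map (swap p x y) fs = map p fs.
Proof.
move=> xf yf; apply/eq_in_map => t tf; rewrite ffunE tpermD //.
  by apply: contraNneq xf => ->.
by apply: contraNneq yf => ->.
Qed.

Section Step.
Variables (U : {set P}) (es : seq (P * P)) (fs : seq P).
Hypotheses (Ue : forall x, x \in U -> x \notin ends es)
  (Uf : forall x, x \in U -> x \notin fs).

Lemma interp_field_sym x y : x \in U -> y \in U -> interp es (x :: fs) = interp es (y :: fs).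
Proof.
move=> xU yU; rewrite /interp (big_words_swap _ _ _ x y); apply: eq_bigr => p _.
by rewrite swap_energy ?Ue //= swap_fields ?Uf // ffunE tpermL.
Qed.

Lemma interp_edge_tperm x y (a b : P) : a \in U -> b \in U ->
  interp ((x, y) :: es) fs = interp ((tperm a b x, tperm a b y) :: es) fs.
Proof.
move=> aU bU; rewrite /interp (big_words_swap _ _ _ a b); apply: eq_bigr => p _.
by rewrite /= swap_energy ?Ue //= swap_fields ?Uf // !ffunE.
Qed.

Lemma interp_edge_sym x y x' y' : x \in U -> y \in U -> x' \in U -> y' \in U ->
  x != y -> x' != y' -> interp ((x, y) :: es) fs = interp ((x', y') :: es) fs.
Proof.
move=> xU yU xU' yU' xy xy'.
rewrite (interp_edge_tperm x y xU xU') tpermL; set t := tperm x x' y.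
have tU : t \in U by rewrite /t; case: tpermP.
have tx : t != x' by rewrite /t -[x' in X in _ != X](tpermL x x') (inj_eq perm_inj) eq_sym.
by rewrite (interp_edge_tperm x' t tU yU') tpermL tpermD // eq_sym.
Qed.

Lemma interp_step x y x' : x \in U -> y \in U -> x != y -> x' \in U ->
  (#|U|%:R - 1) * interp ((x, y) :: es) fs <=
  #|U|%:R * (2 * interp es (x' :: fs) - edge_weight * interp es fs).
Proof.
move=> xU yU xy xU'; set u : R := #|U|%:R.
have u0 : 0 < u :> R by rewrite ltr0n; apply/card_gt0P; exists x.
suff : u * ((u - 1) * interp ((x, y) :: es) fs) <=
   u * (u * (2 * interp es (x' :: fs) - edge_weight * interp es fs)) by rewrite ler_pM2l.
apply: (@le_trans _ _ (\sum_(p in words P V d) \sum_(a in U) \sum_(b in U)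
   field_avg (map p fs) (add_edge (edge_energy p es) (p a) (p b)))).
  have -> : u * ((u - 1) * interp ((x, y) :: es) fs) =
      \sum_(a in U) \sum_(b in U | b != a) interp ((a, b) :: es) fs.
    transitivity (\sum_(a in U) \sum_(b in U | b != a) interp ((x, y) :: es) fs).
      rewrite (eq_bigr (fun=> (u - 1) * interp ((x, y) :: es) fs)).
        by rewrite sumr_const mulr_natl.
      move=> a aU; have := sumr_const (mem U) (interp ((x, y) :: es) fs).
      by rewrite -mulr_natl -/u (bigD1 a) //= => /(canRL (addKr _)) ->; ring.
    apply: eq_bigr => a aU; apply: eq_bigr => b /andP[bU ab].
    by apply: interp_edge_sym; rewrite // eq_sym.
  rewrite [X in _ <= X]exchange_big /=; apply: ler_sum => a aU.
  rewrite [X in _ <= X]exchange_big /= [X in _ <= X](bigID (fun b => b != a)) /=.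
  rewrite lerDl; apply: sumr_ge0 => b _; apply: sumr_ge0 => p _.
  by rewrite ltW ?field_avg_gt0.
apply: (@le_trans _ _ (\sum_(p in words P V d)
   (2 * u * (\sum_(a in U) field_avg (map p (a :: fs)) (edge_energy p es))
    - u ^+ 2 * edge_weight * field_avg (map p fs) (edge_energy p es)))).
  apply: ler_sum => p _.
  have := edge_le_fields [seq p a | a <- enum U] (map p fs) (edge_energy p es).
  rewrite size_map -cardE -/u !big_map !big_enum /=.
  by under eq_bigr do rewrite big_map big_enum.
rewrite sumrB -!mulr_sumr exchange_big /= -/(interp es fs).
rewrite (eq_bigr (fun=> interp es (x' :: fs))).
  rewrite sumr_const -[X in 2 * u * X]mulr_natl -/u le_eqVlt.
  by apply/orP; left; apply/eqP; ring.
by move=> a aU; apply: interp_field_sym.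
Qed.

End Step.
End Interpolation.

(** * The interpolation path and its endpoints *)

Section Window.
Variables (R : realFieldType) (g : nat -> nat -> R) (D k L : nat) (c B : R).
Hypothesis gstep : forall m f, (2 * m + f + k + 2 <= D)%N ->
  g m.+1 f <= 2 * g m f.+1 - g m f + B.
Hypothesis glip : forall m f, g m f - c <= g m f.+1 <= g m f.

Let S m f := \sum_(j < L) g m (f + j).

Lemma lip_iter m f j : g m f - c *+ j <= g m (f + j) <= g m f.
Proof.
elim: j => [|j IH]; first by rewrite mulr0n subr0 addn0 lexx.
rewrite addnS mulrSr; have := glip m (f + j)%N; move: IH; lra.
Qed.

(* Averaging over a window turns the discrete derivative [2 * (g m f.+1 - g m f)]
   of the step inequality into a shift by 2, up to a boundary term. *)
Lemma window_step m f : (2 * m + f + k + L + 1 <= D)%N ->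
  S m.+1 f <= S m (f + 2) + (B *+ L + c).
Proof.
move=> hD.
have h1 : S m.+1 f <= \sum_(j < L) (2 * (g m (f + j).+1 - g m (f + j)) + (g m (f + j) + B)).
  by apply: ler_sum => j _; have := @gstep m (f + j)%N; have := ltn_ord j => hj /(_ ltac:(lia)); lra.
have tel : forall f', \sum_(j < L) (g m (f' + j).+1 - g m (f' + j)%N) = g m (f' + L)%N - g m f'.
  move=> f'; rewrite -(big_mkord xpredT (fun j => g m (f' + j).+1 - g m (f' + j)%N)).
  by rewrite (telescope_sumr_eq (fun j => g m (f' + j)%N)) ?addn0 // => j _; rewrite addnS.
(* The shift by 2 telescopes to the increments across the windows at [f] and [f.+1], whereas [h1]
   contains the one at [f] twice; these increments differ by at most [c]. *)
have h2 : S m (f + 2) = S m f + (g m (f + L)%N - g m f) + (g m (f.+1 + L)%N - g m f.+1).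
  rewrite -!tel /S -!big_split /=; apply: eq_bigr => j _.
  by rewrite addnAC addn2 !addSn; ring.
move: h1; rewrite big_split /= -mulr_sumr tel big_split /= sumr_const card_ord h2 -/(S m f).
have := glip m f; have := glip m (f + L)%N; rewrite addSn; lra.
Qed.

(** Each step trades one edge for two fields, so [2 * m + f] is constant and the room left stays
    sufficient. *)
Lemma window_iter m f : (2 * m + f + k + L <= D)%N ->
  S m f <= S 0 (f + 2 * m) + (B *+ L + c) *+ m.
Proof.
elim: m f => [|m IH] f hD; first by rewrite addn0 mulr0n addr0.
have := @window_step m f ltac:(lia); have := IH (f + 2)%N ltac:(lia).
by rewrite -addnA -mulnS mulrS; lra.
Qed.

(** The terms of a window lie within [c *+ L] of the first, so dividing by [L] turns window sums
    back into single values and dilutes the boundary cost to [c / L] per step. *)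
Lemma window_bound N : (0 < L)%N -> (2 * N + k + L <= D)%N ->
  g N 0%N <= g 0%N (2 * N)%N + (B + c / L%:R) *+ N + c *+ L.
Proof.
move=> L0 hD; have c0 : 0 <= c by have := glip 0 0; lra.
have L0' : 0 < L%:R :> R by rewrite ltr0n.
have := @window_iter N 0%N ltac:(lia).
have h1 : (g N 0%N - c *+ L) *+ L <= S N 0%N.
  have <- : \sum_(j < L) (g N 0%N - c *+ L) = (g N 0%N - c *+ L) *+ L.
    by rewrite sumr_const card_ord.
  apply: ler_sum => j _; have /andP[+ _] := lip_iter N 0 j; apply: le_trans.
  by rewrite lerD2l lerN2 ler_wpMn2l // ltnW.
have h2 : S 0%N (2 * N)%N <= g 0%N (2 * N)%N *+ L.
  have <- : \sum_(j < L) g 0%N (2 * N)%N = g 0%N (2 * N)%N *+ L.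
    by rewrite sumr_const card_ord.
  by apply: ler_sum => j _; have /andP[] := lip_iter 0 (2 * N) j.
rewrite add0n => h3.
rewrite -(ler_pM2l L0') !mulrDr.
have -> : L%:R * ((B + c / L%:R) *+ N) = (B *+ L + c) *+ N.
  by rewrite mulrnAr mulrDr mulrCA mulfV ?gt_eqF // mulr1 mulr_natl.
rewrite !mulr_natl; move: h1; rewrite mulrnBl; lra.
Qed.

End Window.

(** * Energies that decouple over the vertices *)

Section Separable.
Variables (R : realFieldType) (V : finType) (al z : R).

(** The one-vertex form of [field_avg]: [i] and [j] count the fields of either sign received so far,
    [k] those still to be drawn, and the better colour pays [minn i j]. *)
Fixpoint site_avg k (i j : nat) : R :=
  if k is k'.+1 then (1 - 2 * al) * site_avg k' i j +
     al * (site_avg k' i.+1 j + site_avg k' i j.+1)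
  else z ^+ minn i j.

Lemma site_avg_gt0 k i j : 0 < al -> al <= 1 / 2 -> 0 < z -> 0 < site_avg k i j.
Proof.
move=> al0 al1 z0; elim: k i j => [|k IH] i j /=; first exact: exprn_gt0.
rewrite ltr_wpDl //; last by rewrite mulr_gt0 ?addr_gt0.
by apply: mulr_ge0 (ltW (IH i j)); lra.
Qed.

Definition separable (g : V -> bool -> nat) (c : {ffun V -> bool}) :=
  (\sum_v g v (c v))%N.

Lemma ground_separable g : ground (separable g) = (\sum_v minn (g v true) (g v false))%N.
Proof.
apply/eqP; rewrite eqn_leq; apply/andP; split.
  apply: (leq_trans (ground_le (separable g) [ffun v => (g v true <= g v false)%N])).
  by apply: leq_sum => v _; rewrite ffunE; case: (leqP (g v true)) => _ /=.
apply: le_ground => c; apply: leq_sum => v _.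
by case: (c v); rewrite ?geq_minl ?geq_minr.
Qed.

(** A field at [a] keeps the energy separable and touches only the factor of [a], where it is one
    step of the recursion of [site_avg]. *)
Lemma field_avg_separable l g :
  field_avg al z l (separable g) =
  \prod_v site_avg (count_mem v l) (g v true) (g v false).
Proof.
elim: l g => [|a l IH] g /=; first by rewrite ground_separable expr_sum.
pose g' s v t := (g v t + ((v == a) && (t == s)))%N.
have e s : add_field (separable g) a s = separable (g' s).
  apply/funext => c; rewrite /add_field /separable /g' big_split /=; congr (_ + _)%N.
  rewrite (bigD1 a) //= eqxx big1 ?addn0 // => v /negbTE ->.
  by [].
rewrite !e !IH [in RHS](bigD1 a) //= eqxx add1n /=.
rewrite !(bigD1 a (P := xpredT)) //= /g' !eqxx /= !addn0 !addn1.
have e' s : \prod_(i | i != a) site_avg (count_mem i l) (g i true + ((i == a) && (true == s)))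
     (g i false + ((i == a) && (false == s))) =
   \prod_(i | i != a) site_avg (count_mem i l) (g i true) (g i false).
  by apply: eq_bigr => i /negbTE ->; rewrite !addn0.
rewrite !e'; have -> : \prod_(i | i != a) site_avg ((a == i) + count_mem i l) (g i true) (g i false) =
   \prod_(i | i != a) site_avg (count_mem i l) (g i true) (g i false).
  by apply: eq_bigr => i ia; rewrite eq_sym (negbTE ia).
by ring.
Qed.

End Separable.

(** * The reflected walk and the matrix A *)

Section Matrix.
Variables (R : realType) (d : nat) (al z : R).
Hypotheses (d_gt0 : (0 < d)%N) (z_gt0 : 0 < z).

Lemma Mmat_mul (v : 'cV[R]_d.+1) (i : 'I_d.+1) : (i < d)%N ->
  (Mmat R d *m v) i 0 = if i == 0%N :> nat then v (inord 1) 0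
    else (v (inord i.-1) 0 + v (inord i.+1) 0) / 2.
Proof.
move=> id; rewrite mxE.
have vi j : (j <= d)%N -> (inord j : 'I_d.+1) = j :> nat by move=> jd; apply: inordK.
have [i0|i0] := eqVneq (i : nat) 0%N.
  rewrite (bigD1 (inord 1)) //= !mxE i0 eqxx vi // eqxx mul1r big1 ?addr0 // => j.
  rewrite -val_eqE /= vi // mxE i0 eqxx => /negbTE ->.
  by rewrite mul0r.
have ne : (inord i.-1 : 'I_d.+1) != inord i.+1.
  by rewrite -val_eqE /= !vi //; lia.
rewrite (bigD1 (inord i.-1)) //= (bigD1 (inord i.+1)) 1?eq_sym //= !mxE.
rewrite (negbTE i0) (ltn_eqF id) !vi ?eqxx ?orbT /=; [|lia|lia].
rewrite big1 ?addr0; first by field.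
move=> j; rewrite -!val_eqE /= !vi; [|lia|lia] => /andP[/negbTE j1 /negbTE j2].
by rewrite mxE (negbTE i0) (ltn_eqF id) j1 j2 mul0r.
Qed.

(** Twice [minn i j] is [i + j] minus [|i - j|]. Each nonvoid field gives a factor [sqrt z] through
    [i + j], while [|i - j|], written with truncated subtractions, is a walk reflected at 0;
    [o + k <= d] keeps it inside the index range. *)
Lemma site_avg_Amat k i j (o : 'I_d.+1) : o = (i - j + (j - i))%N :> nat -> (o + k <= d)%N ->
  site_avg al z k i j = Num.sqrt z ^+ (i + j) * ((Amat d al z ^+ k) *m xi_col d z) o 0.
Proof.
set q := Num.sqrt z.
have q0 : q != 0 by rewrite sqrtr_eq0 -ltNge.
have qz : q ^+ 2 = z by rewrite sqr_sqrtr // ltW.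
elim: k i j o => [|k IH] i j o oij ok.
  rewrite expr0 mul1mx mxE /= -/q -qz -exprM.
  have -> : (i + j = 2 * minn i j + o)%N by rewrite oij; lia.
  by rewrite exprD exprVn -mulrA mulfV ?mulr1 // expf_neq0.
have od : (o < d)%N by lia.
have vi m : (m <= d)%N -> (inord m : 'I_d.+1) = m :> nat by move=> md; apply: inordK.
rewrite exprS -mulmxE -mulmxA mulmxDl mul_scalar_mx -scalemxAl.
set v := (_ ^+ k) *m _ in IH *.
rewrite mxE [X in X + _]mxE [X in _ + X]mxE Mmat_mul // -/q /=.
rewrite (IH i j o) //; last by lia.
(* From [i = j] both signs lead to distance 1: this is the entry 1 in row 0. *)
have [zo|zo] := eqVneq (o : nat) 0%N.
  rewrite !(IH _ _ (inord 1)) ?vi //; try lia.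
  by rewrite addSn addnS exprS; ring.
have [ij|ij] := ltnP i j.
  rewrite (IH i.+1 j (inord o.-1)) ?vi; [|lia..].
  rewrite (IH i j.+1 (inord o.+1)) ?vi; [|lia..].
  by rewrite addSn addnS exprS; field.
rewrite (IH i.+1 j (inord o.+1)) ?vi; [|lia..].
rewrite (IH i j.+1 (inord o.-1)) ?vi; [|lia..].
by rewrite addSn addnS exprS; field.
Qed.

Lemma site_avg_zeta : site_avg al z d 0 0 =
  (zeta_row R d *m (Amat d al z ^+ d) *m xi_col d z) 0 0.
Proof.
have zE j : zeta_row R d 0 j = (j == ord0)%:R by rewrite mxE -val_eqE; case: eqP.
rewrite (@site_avg_Amat d 0 0 ord0) // expr0 mul1r -mulmxA [RHS]mxE (bigD1 ord0) //=.
rewrite zE eqxx mul1r big1 ?addr0 // => j /negbTE j0.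
by rewrite zE j0 mul0r.
Qed.

End Matrix.

(** * The order in which half-edges are used, and the bound along the path *)

Section HalfEdges.
Variable H : nat.
Local Notation P := ('I_H.+1 * bool)%type.

Definition partner (x : P) : P := (x.1, ~~ x.2).

Lemma partnerK : involutive partner.
Proof. by case=> i b; rewrite /partner /= negbK. Qed.

Lemma partner_neq x : partner x != x.
Proof. by case: x => i [] /=; apply/eqP => -[]. Qed.

Lemma card_half_edges : #|{: P}| = (2 * H.+1)%N.
Proof. by rewrite card_prod card_ord card_bool mulnC. Qed.

Fixpoint edge_seq m : seq (P * P) :=
  if m is m'.+1 then ((inord m', false), (inord m', true)) :: edge_seq m' else [::].

(** Edges fill the indices from 0 upwards and fields from [H] downwards, two per index, so they do
    not meet while [2 * m + f <= 2 * H.+1]. *)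
Definition field_pos f : P := (inord (H - f./2), odd f).

Fixpoint field_seq f : seq P :=
  if f is f'.+1 then field_pos f' :: field_seq f' else [::].

Lemma mem_edge_seq m x : (m <= H.+1)%N -> x \in ends (edge_seq m) -> (x.1 < m)%N.
Proof.
elim: m => //= m IH mH; rewrite /ends /= inE mem_cat inE.
have im : (inord m : 'I_H.+1) = m :> nat by rewrite inordK.
have {}IH : x \in ends (edge_seq m) -> (x.1 < m.+1)%N by move=> /IH h; apply: ltnW; apply: h; lia.
case/orP => [/eqP->|]; first by rewrite /= im.
case/orP => [xe|]; first by apply: IH; rewrite mem_cat xe.
case/orP => [/eqP->|xe]; first by rewrite /= im.
by apply: IH; rewrite mem_cat xe orbT.
Qed.

Lemma field_posE f : (f < 2 * H.+1)%N -> (field_pos f).1 = (H - f./2)%N :> nat.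
Proof. by move=> hf; rewrite inordK //; lia. Qed.

Lemma mem_field_seq f x : x \in field_seq f -> exists2 j, (j < f)%N & x = field_pos j.
Proof.
elim: f => //= f IH; rewrite inE => /predU1P[->|/IH[j jf ->]]; first by exists f.
by exists j => //; apply: ltnW.
Qed.

Lemma field_pos_inj f j : (f < 2 * H.+1)%N -> (j < f)%N -> field_pos f != field_pos j.
Proof.
move=> fH jf; apply/eqP => e.
have := congr1 (fun x : P => nat_of_ord x.1) e; have /= := congr1 snd e.
rewrite !field_posE; lia.
Qed.

Lemma uniq_field_seq f : (f <= 2 * H.+1)%N -> uniq (field_seq f).
Proof.
elim: f => //= f IH fH; rewrite IH ?andbT; last exact: ltnW.
apply/negP => /mem_field_seq[j jf e].
by have := field_pos_inj fH jf; rewrite e eqxx.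
Qed.

Lemma size_field_seq f : size (field_seq f) = f.
Proof. by elim: f => //= f ->. Qed.

Lemma size_ends m : size (ends (edge_seq m)) = (2 * m)%N.
Proof. by rewrite size_cat !size_map; elim: m => //= m IH; lia. Qed.

Definition unused m f : {set P} := [set x | x \notin ends (edge_seq m) ++ field_seq f].

Lemma card_unused m f : (2 * H.+1 - (2 * m + f) <= #|unused m f|)%N.
Proof.
rewrite -card_half_edges -(cardsC (unused m f)) leq_subLR addnC leq_add2r.
rewrite -size_ends -[f in X in (_ <= X)%N]size_field_seq -size_cat.
apply: leq_trans (card_size _); apply/subset_leq_card/fintype.subsetP => x.
by rewrite !inE negbK.
Qed.

Lemma unused_edge m f b : (2 * m + f + 2 <= 2 * H.+1)%N -> (inord m, b) \in unused m f.
Proof.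
move=> hm; have im : (inord m : 'I_H.+1) = m :> nat by rewrite inordK //; lia.
rewrite inE mem_cat; apply/negP => /orP[/mem_edge_seq|/mem_field_seq[j jf e]].
  by rewrite /= im ltnn => h; have := h ltac:(lia).
have := congr1 (fun x : P => nat_of_ord x.1) e; rewrite field_posE ?im /=; lia.
Qed.

Lemma unused_field m f : (2 * m + f + 1 <= 2 * H.+1)%N -> field_pos f \in unused m f.
Proof.
move=> hm; rewrite inE mem_cat; apply/negP => /orP[/mem_edge_seq|/mem_field_seq[j jf e]].
  by rewrite field_posE; lia.
by have := @field_pos_inj f j ltac:(lia) jf; rewrite e eqxx.
Qed.

Section Bound.
Variables (R : realType) (V : finType) (d : nat) (al z : R).
Hypotheses (al_gt0 : 0 < al) (al_le : al <= 1 / 2) (z_gt0 : 0 < z) (z_lt1 : z < 1).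
Hypothesis words_gt0 : (0 < #|words P V d|)%N.

Let X m f := interp V d al z (edge_seq m) (field_seq f).
Let g m f := ln (X m f).

Let X_gt0 m f : 0 < X m f. Proof. exact: interp_gt0. Qed.

Lemma edge_weight_gt0 : 0 < edge_weight al z.
Proof.
have h : al ^+ 2 <= (1 / 2) ^+ 2 by rewrite lerXn2r ?nnegrE //; move: al_gt0; lra.
have h2 : 0 <= al ^+ 2 * z by rewrite mulr_ge0 ?sqr_ge0 // ltW.
by rewrite /edge_weight -mulrA; move: (al ^+ 2) (al ^+ 2 * z) h h2 => a b; rewrite expr2; lra.
Qed.

Lemma edge_weight_le1 : edge_weight al z <= 1.
Proof.
have : al ^+ 2 * z <= al ^+ 2 by rewrite ger_pMr ?exprn_gt0 // ltW.
by rewrite /edge_weight -mulrA; lra.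
Qed.

Lemma ln_interp_step k m f : (2 * m + f + k + 2 <= 2 * H.+1)%N ->
  g m.+1 f <= 2 * g m f.+1 - g m f + (- ln (edge_weight al z) + k.+1%:R^-1).
Proof.
move=> hk; pose u : R := #|unused m f|%:R.
have uk : k.+1%:R <= u - 1.
  rewrite lerBrDr natr1 ler_nat; have := card_unused m f; lia.
have k0 : 0 < k.+1%:R :> R by rewrite ltr0n.
have u1 : 0 < u - 1 by apply: lt_le_trans uk.
have step : (u - 1) * X m.+1 f <= u * (2 * X m f.+1 - edge_weight al z * X m f).
  apply: (@interp_step R P V d al z _ _ _ _ (unused m f)) => //; 
    rewrite ?unused_edge ?unused_field //; try lia.
  - by move=> x; rewrite inE mem_cat => /norP[].
  - by move=> x; rewrite inE mem_cat => /norP[].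
  - by apply/eqP => -[].
have w0 := edge_weight_gt0.
have sq : edge_weight al z * X m f * ((u - 1) * X m.+1 f) <= u * X m f.+1 ^+ 2.
  have c0 : 0 <= edge_weight al z * X m f by rewrite mulr_ge0 // ltW.
  apply: (le_trans (ler_wpM2l c0 step)); rewrite mulrCA ler_wpM2l ?ler0n //.
  have := sqr_ge0 (X m f.+1 - edge_weight al z * X m f); rewrite sqrrB; lra.
have u0 : 0 < u by lra.
have pos := (mulr_gt0, exprn_gt0, X_gt0, w0, u0, u1).
have : ln (edge_weight al z * X m f * ((u - 1) * X m.+1 f)) <= ln (u * X m f.+1 ^+ 2).
  by rewrite ler_ln ?posrE ?pos.
rewrite [ln (u * _)]lnM ?posrE ?pos // [ln (_ * _ * _)]lnM ?posrE ?pos //.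
rewrite [ln (edge_weight al z * _)]lnM ?posrE ?pos // [ln ((u - 1) * _)]lnM ?posrE ?pos //.
rewrite lnXn // -/(g m f) -/(g m.+1 f) -/(g m f.+1).
have : ln u - ln (u - 1) <= k.+1%:R^-1.
  rewrite -ln_div ?posrE //.
  have -> : u / (u - 1) = 1 + (u - 1)^-1 by field; rewrite gt_eqF.
  have inv0 : 0 < (u - 1)^-1 by rewrite invr_gt0.
  apply: (le_trans (le_ln1Dx (lt_trans (ltrN10 R) inv0))).
  by rewrite lef_pV2 ?posrE.
move: (ln u) (ln (u - 1)) (g m f) (g m.+1 f) (g m f.+1) (ln _) (k.+1%:R^-1).
by move=> a b x y t e f0; rewrite mulr2n; lra.
Qed.

Lemma ln_interp_lip m f : g m f - (- ln z) <= g m f.+1 <= g m f.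
Proof.
have /andP[lo hi] := interp_field V d al_gt0 al_le z_gt0 z_lt1 (edge_seq m) (field_seq f) (field_pos f).
apply/andP; split; last by rewrite /g ler_ln ?posrE.
by rewrite opprK addrC /g -lnM ?posrE // ler_ln ?posrE ?mulr_gt0.
Qed.

Hypothesis card_V : (#|V| * d = 2 * H.+1)%N.

(** The fields now occupy every half-edge once, so each vertex gets exactly [d] of them and all
    words contribute the same product. *)
Lemma interp_fields : X 0 (2 * H.+1) = #|words P V d|%:R * site_avg al z d 0 0 ^+ #|V|.
Proof.
transitivity (\sum_(p in words P V d) site_avg al z d 0 0 ^+ #|V|); last first.
  by rewrite sumr_const mulr_natl.
apply: eq_bigr => p pW; rewrite [edge_energy _ _]/=.
have -> : (fun=> 0%N) = separable (fun (v : V) (_ : bool) => 0%N).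
  by apply/funext => c; rewrite /separable big1.
rewrite field_avg_separable.
transitivity (\prod_(v : V) site_avg al z d 0 0); last by rewrite prodr_const.
apply: eq_bigr => v _; congr (site_avg _ _ _ _ _).
rewrite count_map -[RHS](card_word v pW) -size_filter.
have [_ mem] : (size (field_seq (2 * H.+1)) = size (enum {: P})) *
    (field_seq (2 * H.+1) =i enum {: P}).
  apply: uniq_min_size; first exact: uniq_field_seq.
    by move=> x _; rewrite mem_enum.
  by rewrite size_field_seq -cardE card_half_edges.
have /card_uniqP <- := filter_uniq (preim p (pred1 v)) (uniq_field_seq (leqnn _)).
by apply: eq_card => x; rewrite mem_filter mem mem_enum andbT inE.
Qed.

(** The window argument needs [k + L] spare half-edges, so it is run with [N] edges. The remaining
    edges only lower the moment, and completing the fields costs at most [- ln z] each. *)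
Lemma ln_interp_bound k L N : (0 < L)%N -> (2 * N + k + L <= 2 * H.+1)%N ->
  ln (interp V d al z (edge_seq H.+1) [::]) <=
  ln #|words P V d|%:R + ln (site_avg al z d 0 0) *+ #|V| - ln (edge_weight al z) *+ H.+1
  + (k.+1%:R^-1 - ln z / L%:R) *+ N - ln z *+ L - ln z *+ (2 * H.+1 - 2 * N).
Proof.
move=> L0 hN; rewrite -/(X H.+1 0) -/(g H.+1 0).
have mono m j : g (m + j) 0 <= g m 0.
  elim: j => [|j IH]; first by rewrite addn0.
  rewrite addnS; apply: le_trans IH; rewrite ler_ln ?posrE //.
  exact: interp_edge.
have /subnKC eN : (N <= H.+1)%N by lia.
have h1 := mono N (H.+1 - N)%N; rewrite eN in h1.
have h2 := window_bound (@ln_interp_step k) ln_interp_lip L0 hN.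
have /andP[h3 _] := lip_iter ln_interp_lip 0 (2 * N) (2 * H.+1 - 2 * N).
have phi0 : 0 < site_avg al z d 0 0.
  exact: site_avg_gt0.
have h4 : g 0 (2 * H.+1) = ln #|words P V d|%:R + ln (site_avg al z d 0 0) *+ #|V|.
  by rewrite /g interp_fields lnM ?posrE ?exprn_gt0 ?ltr0n // lnXn.
(* As the edge weight is at most 1, counting it [H.+1] times instead of [N] only weakens the
   bound. *)
have wN : - ln (edge_weight al z) *+ N <= - ln (edge_weight al z) *+ H.+1.
  apply: ler_wpMn2l; last by lia.
  by rewrite oppr_ge0 ln_le0 // edge_weight_le1.
rewrite subnKC in h3; last by lia.
rewrite h4 mulNrn in h3; rewrite mulNr !mulrnDl !mulNrn in h2; rewrite !mulNrn in wN.
rewrite !mulrnDl !mulNrn; move: h1 h2 h3 wN.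
move: (ln (edge_weight al z) *+ N) (k.+1%:R^-1 *+ N) (ln z / L%:R *+ N) (ln z *+ L).
move: (ln z *+ _) (ln _ *+ H.+1) (g H.+1 0) (g N 0) (g 0 _) (ln #|_|%:R) (ln _ *+ #|V|).
by move=> *; lra.
Qed.

End Bound.
End HalfEdges.

(** * Regular graphs *)

Section Graphs.
Variables (H n d : nat).
Hypothesis nd : (n * d = 2 * H.+1)%N.
Local Notation P := ('I_H.+1 * bool)%type.
Local Notation V := 'I_n.
Local Notation simple := (simple_words V (@partner H) d).

Definition mono (e : {set V}) (c : {ffun V -> bool}) : bool :=
  [forall x in e, forall y in e, c x == c y].

Definition mono_energy (E : {set {set V}}) (c : {ffun V -> bool}) : nat :=
  (\sum_(e in E) mono e c)%N.

Lemma mono2 a b c : mono [set a; b] c = (c a == c b).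
Proof.
apply/forall_inP/idP => [h|/eqP ab x].
  by have /forall_inP := h a (set21 _ _); apply; rewrite set22.
rewrite !inE => hx; apply/forall_inP => y; rewrite !inE => hy.
by case/orP: hx => /eqP ->; case/orP: hy => /eqP ->; rewrite ?ab.
Qed.

Lemma hamiltonian_mono (R : realType) (E : {set {set V}}) c : is_simple_graph E ->
  hamiltonian R E c = (mono_energy E c)%:R.
Proof.
move=> /forall_inP sE; rewrite /hamiltonian /mono_energy natr_sum.
apply: eq_bigr => e eE; have /cards2P[a [b [ab ->]]] := sE e eE.
rewrite mono2 big_setU1 ?inE //= big_set1 /spin.
by case: (c a); case: (c b) => /=; field.
Qed.

Lemma edge_energy_sum (p : {ffun P -> V}) m c : edge_energy p (edge_seq H m) c =
  (\sum_(i < m) (c (p (inord i, false)) == c (p (inord i, true))))%N.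
Proof.
elim: m => [|m IH] /=; first by rewrite big_ord0.
by rewrite big_ord_recr /= -IH.
Qed.

(** In a simple word the matched pairs give distinct edges, so the sum over pairs is a sum over the
    edge set. *)
Lemma edge_energy_graph (p : {ffun P -> V}) : p \in simple ->
  edge_energy p (edge_seq H H.+1) = mono_energy (graph (@partner H) p).
Proof.
move=> pS; apply/funext => c; rewrite edge_energy_sum /mono_energy.
pose e (i : 'I_H.+1) := [set p (i, false); p (i, true)].
have -> : graph (@partner H) p = e @: [set: 'I_H.+1].
  apply/setP => x; apply/imsetP/imsetP => [[[i b] _ ->]|[i _ ->]].
    by exists i; rewrite ?inE //; case: b; rewrite /e /partner //= finset.setUC.
  by exists (i, false).
rewrite big_imset /=; last first.
  move=> i j _ _ /set2_inj; have /simpleP[_ inj] := pS => -[[e1 e2]|[e1 e2]].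
    by have [] := inj (j, false) (i, false) e1 e2.
  by have [] := inj (j, true) (i, false) e1 e2.
by apply: eq_big => [i|i _]; rewrite ?inE // mono2 inord_val.
Qed.

Lemma graph_reg (p : {ffun P -> V}) : p \in simple ->
  graph (@partner H) p \in reg_graphs n d.
Proof.
move=> pS; rewrite [_ \in reg_graphs _ _]finset.in_set; apply/andP; split.
  by apply/forall_inP => e eE; rewrite (graph_simple (@partnerK H) (@partner_neq H) pS eE).
apply/forallP => v; apply/eqP.
exact: (graph_degree (@partnerK H) (@partner_neq H) v pS).
Qed.

Lemma card_reg_graph E : E \in reg_graphs n d -> #|E| = H.+1.
Proof.
rewrite [_ \in reg_graphs _ _]finset.in_set => /andP[/forall_inP sE /forallP rE].
have : (\sum_(e in E) #|e| = n * d)%N.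
  transitivity (\sum_(e in E) \sum_(v in e) 1)%N.
    by apply: eq_bigr => e _; rewrite sum1_card.
  rewrite (exchange_big_dep xpredT) //= -[n in RHS]card_ord -sum_nat_const.
  by apply: eq_bigr => v _; rewrite sum1dep_card (eqP (rE v)).
rewrite (eq_bigr (fun=> 2)%N) => [|e eE]; last exact/eqP/sE.
by rewrite sum_nat_const nd mulnC => /eqP; rewrite eqn_pmul2l // => /eqP.
Qed.

(** Number the edges by [enum] and order the ends of each arbitrarily. Regularity makes this a word;
    distinct edges without loops make it simple. *)
Lemma reg_graph_word E : E \in reg_graphs n d ->
  exists2 p, p \in simple & graph (@partner H) p = E.
Proof.
move=> ER; have cE := card_reg_graph ER.
move: ER; rewrite [_ \in reg_graphs _ _]finset.in_set => /andP[/forall_inP sE /forallP rE].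
pose e (i : 'I_H.+1) := nth finset.set0 (enum E) i.
have sz : size (enum E) = H.+1 by rewrite -cardE.
have eE i : e i \in E by rewrite -mem_enum mem_nth // sz.
have e_inj : injective e.
  move=> i j /eqP; rewrite nth_uniq ?sz ?enum_uniq // => /eqP ij; exact: val_inj.
have e_surj x : x \in E -> exists i, x = e i.
  rewrite -mem_enum => xE; have := xE; rewrite -index_mem sz => ltx.
  by exists (Ordinal ltx); rewrite /e /= nth_index.
have ab i : exists t : V * V, (t.1 != t.2) && (e i == [set t.1; t.2]).
  by have /cards2P[a [b [ab ->]]] := sE _ (eE i); exists (a, b); rewrite /= ab eqxx.
pose ends i := xchoose (ab i).
have ends_neq i : (ends i).1 != (ends i).2 by have /andP[] := xchooseP (ab i).
have endsE i : e i = [set (ends i).1; (ends i).2] by have /andP[_ /eqP] := xchooseP (ab i).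
pose p : {ffun P -> V} := [ffun x : P => if x.2 then (ends x.1).2 else (ends x.1).1].
have pe x : [set p x; p (partner x)] = e x.1.
  by case: x => i []; rewrite !ffunE /= endsE // finset.setUC.
have pl x : p (partner x) != p x.
  by case: x => i []; rewrite !ffunE /= // eq_sym.
exists p.
  apply/simpleP; split.
    rewrite inE; apply/forallP => v; rewrite -(eqP (rE v)); apply/eqP.
    have inj : {in [set x | p x == v] &, injective (fun x => e x.1)}.
      move=> [i b] [j b']; rewrite !inE => /eqP vi /eqP vj /e_inj /= ij; subst j.
      congr (_, _); apply/eqP; apply: contraTT (pl (i, b)) => bb'.
      have -> : partner (i, b) = (i, b') by rewrite /partner /=; case: b b' bb' {vi vj} => -[].
      by rewrite vi vj eqxx.
    rewrite -(card_in_imset inj); apply: eq_card => x.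
    rewrite inE; apply/imsetP/andP => [[y + ->]|[xE vx]].
      rewrite inE => /eqP <-; split; [exact: eE | by rewrite -pe finset.set21].
    have [i xi] := e_surj x xE.
    move: vx; rewrite xi -(pe (i, false)) !inE => /orP[]/eqP vp.
      by exists (i, false); rewrite ?inE ?vp ?pe.
    by exists (partner (i, false)); rewrite ?inE ?vp ?pe.
  move=> x y e1 e2; have : e x.1 = e y.1 by rewrite -!pe e1 e2.
  move/e_inj; move: x y e1 e2 => [i b] [j b'] /= e1 e2 ij; subst j.
  congr (_, _); apply/eqP; apply: contraTT (pl (i, b)) => bb'.
  have -> : partner (i, b) = (i, b') by rewrite /partner /=; case: b b' bb' {e1 e2} => -[].
  by rewrite e1 eqxx.
apply/setP => x; apply/imsetP/idP => [[y _ ->]|/e_surj[i ->]].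
  by rewrite pe.
by exists (i, false); rewrite ?pe.
Qed.

(** All fibres of [graph] have the same size, so a uniform simple word yields the uniform regular
    graph. *)
Lemma sum_simple (R : pzRingType) (f : {set {set V}} -> R) :
  \sum_(p in simple) f (graph (@partner H) p) =
  #|pr_perms (@partner H)|%:R * \sum_(E in reg_graphs n d) f E.
Proof.
rewrite (partition_big (graph (@partner H)) (mem (reg_graphs n d))) => [|p /graph_reg //].
rewrite mulr_sumr; apply: eq_bigr => E ER /=.
have [p0 p0S gp0] := reg_graph_word ER.
rewrite (eq_bigr (fun=> f E)) => [|p /andP[_ /eqP ->] //].
rewrite -(card_fiber (@partnerK H) p0S) gp0 mulr_natl -sumr_const.
by apply: eq_bigl => p; rewrite !inE.
Qed.

Lemma words_neq0 : (0 < #|words P V d|)%N.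
Proof.
have cP : #|{: P}| = #|{: V * 'I_d}| by rewrite card_half_edges card_prod !card_ord nd.
pose b (x : P) : V * 'I_d := enum_val (cast_ord cP (enum_rank x)).
have b_inj : injective b.
  by move=> x y /enum_val_inj /cast_ord_inj /enum_rank_inj.
apply/card_gt0P; exists [ffun x => (b x).1]; rewrite inE; apply/forallP => v.
have [b' bK b'K] : bijective b by apply: inj_card_bij => //; rewrite cP.
rewrite -(card_imset _ b_inj); apply/eqP.
transitivity #|[set (v, j) | j : 'I_d]|; last first.
  by rewrite card_imset ?card_ord // => i j [].
apply: eq_card => -[v' j]; apply/imsetP/imsetP => [[x]|[j' _ [-> ->]]].
  by rewrite inE ffunE => /eqP vx e; exists j => //; rewrite -vx -e.
by exists (b' (v, j')); rewrite ?inE ?ffunE b'K ?eqxx.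
Qed.

End Graphs.

(** * Free energy *)

Section FreeEnergy.
Variables (R : realType) (n d : nat).
Hypothesis n_gt0 : (0 < n)%N.
Implicit Types E : {set {set 'I_n}}.

Definition ground_energy E := ground (mono_energy E).

(** One ground state gives the lower bound; the upper one bounds each of the [2 ^ n] terms by that
    of a ground state. *)
Lemma ln_partition_fn E (beta : R) : 0 <= beta -> is_simple_graph E ->
  - (beta * (ground_energy E)%:R) <= ln (partition_fn E beta)
    <= ln 2 *+ n - beta * (ground_energy E)%:R.
Proof.
move=> b0 sE.
have Z0 : 0 < partition_fn E beta.
  rewrite /partition_fn (bigD1 [ffun=> true]) //= ltr_pwDl ?expR_gt0 //.
  by apply: sumr_ge0 => t _; apply: expR_ge0.
apply/andP; split.
  have [c hc] := ground_ex (mono_energy E).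
  rewrite -[X in X <= _]expRK ler_ln ?posrE ?expR_gt0 //.
  rewrite /partition_fn (bigD1 c) //= (hamiltonian_mono R c sE) hc mulNr.
  by rewrite lerDl; apply: sumr_ge0 => t _; apply: expR_ge0.
have -> : ln 2 *+ n - beta * (ground_energy E)%:R =
    ln (2 ^+ n * expR (- (beta * (ground_energy E)%:R))) :> R.
  by rewrite lnM ?posrE ?expR_gt0 ?exprn_gt0 // expRK lnXn.
rewrite ler_ln ?posrE ?mulr_gt0 ?expR_gt0 ?exprn_gt0 //.
have -> : 2 ^+ n = \sum_(t : {ffun 'I_n -> bool}) 1 :> R.
  by rewrite sumr_const card_ffun card_bool card_ord natrX.
rewrite mulr_suml; apply: ler_sum => t _.
rewrite mul1r ler_expR (hamiltonian_mono R t sE) mulNr lerN2 ler_wpM2l // ler_nat.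
exact: ground_le.
Qed.

Definition mean_ground : R :=
  (\sum_(E in reg_graphs n d) (ground_energy E)%:R) / #|reg_graphs n d|%:R / n%:R.

Lemma avg_free_energy_ground (beta : R) : 0 <= beta ->
  - (beta * mean_ground) <= avg_free_energy n d beta <= ln 2 - beta * mean_ground.
Proof.
move=> b0; rewrite /avg_free_energy /mean_ground.
have n0 : 0 < n%:R :> R by rewrite ltr0n.
have ln2 : 0 <= ln 2 :> R by rewrite ln_ge0 // ler1n.
(* If there is no regular graph, both averages are 0 because the inverse of 0 is 0. *)
have [->|r0] := posnP #|reg_graphs n d|.
  by rewrite invr0 !(mulr0, mul0r) subr0 oppr0 lexx.
have {}r0 : 0 < #|reg_graphs n d|%:R :> R by rewrite ltr0n.
have sE E : E \in reg_graphs n d -> is_simple_graph E.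
  by rewrite [_ \in reg_graphs _ _]finset.in_set => /andP[].
have e : ln 2 = (\sum_(E in reg_graphs n d) ln 2 *+ n) / #|reg_graphs n d|%:R / n%:R :> R.
  rewrite sumr_const -(mulr_natr (ln 2 *+ n)) mulfK ?gt_eqF //.
  by rewrite -(mulr_natr (ln 2)) mulfK ?gt_eqF.
rewrite [X in _ && (_ <= X - _)]e !mulrA -!mulNr -!mulrDl.
rewrite !ler_pM2r ?invr_gt0 // mulr_sumr -big_split /=.
by apply/andP; split; apply: ler_sum => E ER; rewrite mulNr;
  have /andP[] := ln_partition_fn b0 (sE E ER).
Qed.

End FreeEnergy.

(** * From the annealed moment to the mean ground energy *)

Lemma sum_ln_le (R : realType) (I : finType) (A : {set I}) (x : I -> R) :
  (0 < #|A|)%N -> (forall i, 0 < x i) ->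
  \sum_(i in A) ln (x i) <= #|A|%:R * (ln (\sum_(i in A) x i) - ln #|A|%:R).
Proof.
move=> A0 x0; set a : R := #|A|%:R; set S := \sum_(i in A) x i.
have a0 : 0 < a by rewrite ltr0n.
have S0 : 0 < S.
  have /card_gt0P[i iA] := A0.
  by rewrite /S (bigD1 i) //= ltr_pwDl // sumr_ge0 // => j _; rewrite ltW.
(* Jensen's inequality through the tangent of [ln] at the mean [S / a]; the linear corrections sum
   to 0. *)
have h i : ln (x i) <= ln (S / a) + (x i / (S / a) - 1).
  rewrite -lerBlDl -ln_div ?posrE ?divr_gt0 //.
  have -> : ln (x i / (S / a)) = ln (1 + (x i / (S / a) - 1)) by rewrite addrC subrK.
  by apply: le_ln1Dx; rewrite ltrBrDr addNr divr_gt0 ?divr_gt0.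
apply: (le_trans (ler_sum _ (fun i _ => h i))).
rewrite big_split /= sumr_const sumrB -mulr_suml sumr_const -/S -/a ln_div ?posrE //.
have -> : S / (S / a) = a by field; rewrite !gt_eqF.
by rewrite subrr addr0 mulr_natl.
Qed.

Section Bound.
Variables (R : realType) (d : nat) (al z : R).
Hypotheses (d_gt0 : (0 < d)%N)
  (al_gt0 : 0 < al) (al_le : al <= 1 / 2) (z_gt0 : 0 < z) (z_lt1 : z < 1).

Let K := (2 * (d + d * d))%N.

(** Words that are not simple only add to [interp], the number [kap] of words per graph cancels, and
    the density of simple words costs the last two terms. *)
Lemma ln_moment_le H n : (n * d = 2 * H.+1)%N -> (2 * K < 2 * H.+1)%N -> (5 < 2 * H.+1)%N ->
  (0 < #|reg_graphs n d|)%N /\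
  ln (\sum_(E in reg_graphs n d) z ^+ ground_energy E) - ln #|reg_graphs n d|%:R <=
  ln (interp 'I_n d al z (edge_seq H H.+1) [::]) - ln #|words ('I_H.+1 * bool)%type 'I_n d|%:R
   + ln K.+1%:R + ln (((2 * H.+1) ^ 2).+1%:R) *+ K.
Proof.
move=> nd HK H5.
have w0 : (0 < #|words ('I_H.+1 * bool)%type 'I_n d|)%N := words_neq0 nd.
set om := words _ _ _ in w0 *.
pose S := simple_words 'I_n (@partner H) d.
pose kap : R := #|pr_perms (@partner H)|%:R.
have := card_words_simple 'I_n (@partnerK H) (@partner_neq H).
rewrite card_half_edges => /(_ d HK H5); rewrite -/om -/K -/S => hS.
have S0 : (0 < #|S|)%N.
  by move: w0 hS; rewrite lt0n => w0; case: #|S| => //; rewrite !muln0 leqn0 (negbTE w0).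
have card_S : #|S|%:R = kap * #|reg_graphs n d|%:R.
  by have := sum_simple nd (fun=> 1 : R); rewrite !sumr_const.
have k0 : 0 < kap.
  rewrite lt0r ler0n andbT; apply: contraTneq S0 => k0.
  by rewrite -(ltr0n R) card_S k0 mul0r ltxx.
have r0 : 0 < #|reg_graphs n d|%:R :> R.
  by rewrite -(pmulr_rgt0 _ k0) -card_S ltr0n.
split; first by rewrite -(ltr0n R).
have hW : kap * \sum_(E in reg_graphs n d) z ^+ ground_energy E <=
    interp 'I_n d al z (edge_seq H H.+1) [::].
  have eg := @edge_energy_graph H n d; move: (edge_seq H H.+1) eg => es eg.
  rewrite -(sum_simple nd) /interp /=.
  rewrite [X in _ <= X](bigID (mem S)) /= -[X in X <= _]addr0.
  apply: lerD; last by apply: sumr_ge0 => p _; rewrite exprn_ge0 // ltW.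
  rewrite [X in _ <= X](eq_bigl (mem S)); last first.
    by move=> p /=; apply: andb_idl => /simpleP[].
  by apply: ler_sum => p pS; rewrite /= eg.
set M := \sum_(E in _) _ in hW *.
have M0 : 0 < M.
  have /card_gt0P[E ER] : (0 < #|reg_graphs n d|)%N by rewrite -(ltr0n R).
  rewrite /M (bigD1 E) //= ltr_pwDl ?exprn_gt0 // sumr_ge0 // => E' _.
  by rewrite exprn_ge0 // ltW.
set Wt := interp _ _ _ _ _ _ in hW *.
have Wt0 : 0 < Wt by apply: lt_le_trans hW; rewrite mulr_gt0.
have l1 : ln kap + ln M <= ln Wt.
  by rewrite -lnM ?posrE // ler_ln ?posrE // mulr_gt0.
have l2 : ln #|om|%:R <= ln K.+1%:R + (ln ((2 * H.+1) ^ 2).+1%:R *+ K + (ln kap + ln #|reg_graphs n d|%:R)).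
  rewrite -[ln kap + _]lnM ?posrE // -card_S -lnXn ?ltr0n //.
  rewrite -lnM ?posrE ?exprn_gt0 ?ltr0n // -lnM ?posrE ?mulr_gt0 ?exprn_gt0 ?ltr0n //.
  rewrite ler_ln ?posrE ?mulr_gt0 ?exprn_gt0 ?ltr0n //.
  by rewrite -natrX -!natrM ler_nat.
lra.
Qed.

Let c := - ln z.
Let c_gt0 : 0 < c. Proof. by rewrite /c oppr_gt0 ln_lt0 // z_gt0. Qed.

(** The errors per unit of [k]: the losses of the interpolation steps, the window and the leftover
    fields, the Markov factor, and the switchings. *)
Let C : R := d%:R * (1 + c) + 6 * c + ln K.+1%:R + (8 * d * K)%:R.

(** With [n = 2 * (k * k)] the product [d n] is even for every [d]. Window and reserve of length
    about [k] balance the step losses, of order [n / k], against the boundary costs, of order [k];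
    division by [n] leaves [1 / k]. *)
Lemma mean_ground_le k : (K < k)%N -> (2 < k)%N ->
  - mean_ground R (2 * (k * k)) d <= Fd d al z + C / c / k%:R.
Proof.
move=> Kk k2; set n := (2 * (k * k))%N.
have [H eH] : exists H, H.+1 = (d * (k * k))%N.
  by exists (d * (k * k)).-1; rewrite prednK // muln_gt0 d_gt0; nia.
have nd : (n * d = 2 * H.+1)%N by rewrite eH /n; lia.
have kH : (k * k <= H.+1)%N by rewrite eH; nia.
have kpos : (0 < k)%N by apply: leq_trans k2.
have npos : (0 < n)%N by rewrite !muln_gt0 kpos.
have k3 : (3 * k <= H.+1)%N by apply: leq_trans kH; rewrite leq_mul2r k2 orbT.
have kH' : (k < H)%N by lia.
have hN : (2 * (H - k) + k + k.+1 <= 2 * H.+1)%N by lia.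
have hD : (2 * H.+1 - 2 * (H - k) = 2 * k.+1)%N by lia.
have arith1 : (2 * d * k * (2 * d * k) = 4 * (d * d * (k * k)))%N by lia.
have arith2 : (2 * d * k * 4 <= 8 * d * k)%N by lia.
have arith3 : (8 * d * k * K <= 8 * d * K * k)%N by lia.
have arith4 : (k.+1 + 2 * k.+1 <= 6 * k)%N by lia.
have HK : (2 * K < 2 * H.+1)%N by lia.
have H5 : (5 < 2 * H.+1)%N by lia.
have [r0 hM] := ln_moment_le nd HK H5.
have hW := ln_interp_bound al_gt0 al_le z_gt0 z_lt1 (words_neq0 nd) _ (k := k) (L := k.+1) (N := H - k).
rewrite card_ord nd in hW.
have {hW} := hW erefl (ltn0Sn k) hN.
rewrite site_avg_zeta // => hW.
have J := sum_ln_le r0 (fun E => exprn_gt0 (ground_energy E) z_gt0).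
set lphi := ln ((_ *m _ *m _) _ _) in hW.
set lM := ln (\sum_(E in _) _) - _ in J hM.
have k0 : 0 < k%:R :> R by rewrite ltr0n.
have n0 : 0 < n%:R :> R by rewrite ltr0n.
have nk : n%:R = 2 * k%:R ^+ 2 :> R by rewrite /n !natrM expr2.
have g0 : - mean_ground R n d * (c * n%:R) <= lM.
  rewrite /mean_ground; set r : R := #|_|%:R in J *.
  have rr : 0 < r by rewrite ltr0n.
  set G := \sum_(E in _) _.
  have : - c * G <= r * lM.
    apply: le_trans J; rewrite mulr_sumr le_eqVlt; apply/orP; left; apply/eqP.
    by apply: eq_bigr => E _; rewrite lnXn // /c opprK mulr_natr.
  move=> h; rewrite -(ler_pM2l rr); apply: le_trans h.
  have alg (x y u v : R) : y != 0 -> u != 0 -> y * (- (x / y / u) * (v * u)) = - v * x.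
    by move=> y0 u0; field; apply/andP.
  by rewrite alg ?gt_eqF.
(* Since [H.+1] is [d n / 2], the main terms are exactly [c n] times [Fd]. *)
have F : Fd d al z = (lphi *+ n - ln (edge_weight al z) *+ H.+1) / (c * n%:R).
  have -> : lphi *+ n = lphi * (2 * k%:R ^+ 2) by rewrite -nk mulr_natr.
  have -> : ln (edge_weight al z) *+ H.+1 = ln (edge_weight al z) * (d%:R * k%:R ^+ 2).
    by rewrite eH -(mulr_natr (ln _)) !natrM expr2.
  have alg (a b e u v : R) : u != 0 -> v != 0 ->
      - a / u + e * b / (2 * u) = (a * (2 * v ^+ 2) - b * (e * v ^+ 2)) / (- u * (2 * v ^+ 2)).
    by move=> u0 v0; field; apply/andP.
  have lz : ln z != 0 by rewrite lt_eqF // ln_lt0 // z_gt0.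
  have kz : k%:R != 0 :> R by rewrite gt_eqF.
  by rewrite /Fd -/lphi -/(edge_weight al z) /c nk -(alg _ _ _ _ _ lz kz).
have cn0 : 0 < c * n%:R by rewrite mulr_gt0.
suff err : lM <= (lphi *+ n - ln (edge_weight al z) *+ H.+1) + C * k%:R.
  rewrite -(ler_pM2r cn0); apply: (le_trans g0); apply: (le_trans err).
  rewrite [X in _ <= X]mulrDl F. rewrite divfK ?gt_eqF // lerD2l nk.
  have C0 : 0 <= C.
    rewrite /C !addr_ge0 ?mulr_ge0 ?ler0n ?ln_ge0 ?ler1n // ltW //.
    by rewrite addr_gt0.
  have alg (x y u : R) : y != 0 -> u != 0 -> x / y / u * (y * (2 * u ^+ 2)) = x * u * 2.
    by move=> y0 u0; field; apply/andP.
  rewrite alg ?gt_eqF //.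
  by rewrite ler_peMr ?mulr_ge0 ?ler1n // ltW.
have e1 : (k.+1%:R^-1 - ln z / k.+1%:R) *+ (H - k) <= d%:R * (1 + c) * k%:R.
  have -> : k.+1%:R^-1 - ln z / k.+1%:R = (1 + c) / k.+1%:R by rewrite /c; field.
  rewrite -(mulr_natr (_ / _)) mulrAC ler_pdivrMr ?ltr0n //.
  have -> : d%:R * (1 + c) * k%:R * k.+1%:R = (1 + c) * (d * (k * k.+1))%:R by rewrite !natrM; ring.
  apply: ler_wpM2l; first by rewrite addr_ge0 // ltW.
  rewrite ler_nat; apply: (@leq_trans H.+1).
    by rewrite (leq_trans (leq_subr _ _)).
  by rewrite eH !leq_mul.
have e2 : ln ((2 * H.+1) ^ 2).+1%:R <= (8 * d * k)%:R :> R.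
  (* A crude power of [2 * d * k], whose logarithm is then at most linear in [k] by
     [ln x <= x - 1]. *)
  have h : (((2 * H.+1) ^ 2).+1 <= (2 * d * k) ^ 4)%N.
    rewrite (expnM _ 2 2) ltn_sqr eH -mulnn.
    have t0 : (0 < d * (k * k))%N by rewrite !muln_gt0 d_gt0 kpos.
    have t1 : (d * (k * k) <= d * d * (k * k))%N by rewrite leq_mul2r leq_pmulr ?orbT.
    have arith (x y : nat) : (0 < x -> x <= y -> 2 * x < 4 * y)%N by clear; lia.
    by rewrite arith1 arith.
  have x0 : 0 < (2 * d * k)%:R :> R by rewrite ltr0n !muln_gt0 d_gt0 kpos.
  apply: (@le_trans _ _ (ln ((2 * d * k)%:R ^+ 4))).
    have x4 : 0 < (2 * d * k)%:R ^+ 4 :> R by rewrite exprn_gt0.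
    by rewrite ler_ln ?posrE ?ltr0Sn // -natrX ler_nat.
  rewrite lnXn //; apply: (@le_trans _ _ ((2 * d * k)%:R *+ 4)).
    rewrite lerMn2r /=; have := @le_ln1Dx R ((2 * d * k)%:R - 1).
    rewrite (addrC 1) subrK => /(_ _); have : -1 < (2 * d * k)%:R - 1 :> R by lra.
    by move=> -> /(_ isT); lra.
  by rewrite -(mulr_natr (_ %:R)) -natrM ler_nat.
have e3 : ln ((2 * H.+1) ^ 2).+1%:R *+ K <= (8 * d * K)%:R * k%:R :> R.
  apply: (le_trans (ler_wMn2r K e2)).
  by rewrite -(mulr_natr (_ %:R)) -!natrM ler_nat arith3.
have e4 : ln K.+1%:R <= ln K.+1%:R * k%:R :> R.
  by rewrite ler_peMr ?ln_ge0 ?ler1n.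
have e5 : - (ln z *+ k.+1) - ln z *+ (2 * H.+1 - 2 * (H - k)) <= 6 * c * k%:R.
  rewrite hD -!mulNrn -/c -mulrnDr -(mulr_natl c) mulrAC; apply: ler_wpM2r; first exact: ltW.
  by rewrite -natrM ler_nat.
have eC : C * k%:R = d%:R * (1 + c) * k%:R + 6 * c * k%:R + ln K.+1%:R * k%:R + (8 * d * K)%:R * k%:R.
  by rewrite -!mulrDl.
apply: (le_trans hM); rewrite eC; move: hW e1 e3 e4 e5.
move: (ln (interp _ _ _ _ _ _)) (ln #|words _ _ _|%:R) (ln K.+1%:R) (ln K.+1%:R * _).
move: (lphi *+ n) (ln (edge_weight al z) *+ H.+1) (ln z *+ k.+1) (ln z *+ (2 * H.+1 - 2 * (H - k))).
move: (ln _ *+ K) ((k.+1%:R^-1 - ln z / k.+1%:R) *+ (H - k)).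
move: (d%:R * (1 + c) * k%:R) (6 * c * k%:R) ((8 * d * K)%:R * k%:R).
by clear=> *; lra.
Qed.

End Bound.

(** * The zero-temperature limit *)

Lemma le_of_le_add_eps (R : realFieldType) (x y : R) :
  (forall eps, 0 < eps -> x <= y + eps) -> x <= y.
Proof.
move=> h; rewrite leNgt; apply/negP => yx.
by have := h ((x - y) / 2) ltac:(lra); lra.
Qed.

Local Open Scope classical_set_scope.

Theorem theorem1p2 (R : realType) (d : nat) (Phi : R -> R) :
  (3 <= d)%N ->
  (forall beta : R, 0 < beta ->
     forall eps : R, 0 < eps ->
       exists N : nat, forall n : nat, (N <= n)%N -> ~~ odd (d * n) ->
         `|avg_free_energy n d beta - Phi beta| < eps) ->
  exists L : R,
    (Phi x / x @[x --> +oo] --> L) /\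
    (forall alpha z : R, 0 < alpha -> alpha <= 1 / 2 -> 0 < z -> z < 1 ->
       L <= Fd d alpha z).
Proof.
move=> d3 hPhi; pose ln2 : R := ln 2.
have ln2_ge0 : 0 <= ln2 by rewrite ln_ge0 // ler1n.
pose e k : R := mean_ground R (2 * (k * k)) d.
have even_n k : ~~ odd (d * (2 * (k * k))) by rewrite !oddM andbF.
have approx beta eps : 0 < beta -> 0 < eps -> exists N, forall k, (N <= k)%N ->
    - (beta * e k) - eps <= Phi beta <= ln2 - beta * e k + eps.
  move=> b0 eps0; have [N hN] := hPhi beta b0 eps eps0.
  exists N.+1 => k Nk; have k0 : (0 < k)%N by apply: leq_trans Nk.
  have := hN (2 * (k * k))%N ltac:(nia) (even_n k).
  have := @avg_free_energy_ground R (2 * (k * k)) d ltac:(nia) beta (ltW b0).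
  rewrite -/(e k) -/ln2 ltr_norml => /andP[h1 h2] /andP[h3 h4]; apply/andP; split; lra.
(* Both sides are tied to [- e k] at a common large [k], which cancels; convergence of [e k] is not
   called for. *)
have compare x y : 0 < x -> 0 < y -> Phi x / x - ln2 / x <= Phi y / y.
  move=> x0 y0; apply: le_of_le_add_eps => eps eps0.
  have [N1 h1] := approx x (eps / 2 * x) x0 ltac:(nra).
  have [N2 h2] := approx y (eps / 2 * y) y0 ltac:(nra).
  have /andP[_] := h1 (maxn N1 N2) (leq_maxl _ _).
  have /andP[+ _] := h2 (maxn N1 N2) (leq_maxr _ _); move: (e _) => E hy hx.
  have {}hy : - E - eps / 2 <= Phi y / y by rewrite ler_pdivlMr // mulrBl; lra.
  have {}hx : Phi x / x - ln2 / x <= - E + eps / 2.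
    by rewrite -mulrBl ler_pdivrMr // mulrDl; lra.
  lra.
(* The limit is the supremum of these lower bounds: by [compare] it lies between
   [Phi x / x - ln2 / x] and [Phi x / x]. *)
pose A := [set Phi x / x - ln2 / x | x in [set x : R | 0 < x]]%classic.
have A1 : A !=set0 by exists (Phi 1 / 1 - ln2 / 1), 1 => //=; exact: ltr01.
have ubA y : 0 < y -> ubound A (Phi y / y) by move=> y0 _ [x /= x0 <-]; exact: compare.
have supA : has_sup A by split=> //; exists (Phi 1 / 1); exact: ubA.
exists (sup A); have lo x : 0 < x -> Phi x / x - ln2 / x <= sup A.
  by move=> x0; apply: sup_upper_bound => //; exists x.
have hi x : 0 < x -> sup A <= Phi x / x by move=> x0; apply: sup_le_ub => //; exact: ubA.
split.
  apply/cvgrPdist_le => eps eps0; near=> x.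
  have x0 : 0 < x by near: x; apply: nbhs_pinfty_gt; rewrite num_real.
  have xe : ln2 / eps <= x by near: x; apply: nbhs_pinfty_ge; rewrite num_real.
  have : ln2 / x <= eps by rewrite ler_pdivrMr // mulrC -ler_pdivrMr.
  by have := lo x x0; have := hi x x0; rewrite ler_norml => *; apply/andP; split; lra.
move=> al z al0 al1 z0 z1.
have d0 : (0 < d)%N by apply: leq_trans d3.
(* The entropy term [ln2 / beta] disappears by taking [beta] large; the [+ 1] below keeps the chosen
   [beta] positive. *)
suff main beta : 0 < beta -> sup A <= Fd d al z + ln2 / beta.
  apply: le_of_le_add_eps => eps eps0.
  have b0 : 0 < (ln2 + 1) / eps by rewrite divr_gt0 // ltr_wpDl.
  apply: (le_trans (main _ b0)); rewrite lerD2l ler_pdivrMr //.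
  by rewrite mulrC divfK ?gt_eqF //; lra.
move=> b0; apply: (le_trans (hi _ b0)); apply: le_of_le_add_eps => eps eps0.
have [N hN] := approx beta (eps / 2 * beta) b0 ltac:(nra).
set K := (2 * (d + d * d))%N.
have [C hC] : exists C : R, forall k, (K < k)%N -> (2 < k)%N ->
    - e k <= Fd d al z + C / k%:R.
  by eexists => k; exact: mean_ground_le.
have [M hM] : exists M : nat, `|C| / (eps / 2) <= M%:R.
  exists (Num.bound (`|C| / (eps / 2))); apply/ltW/archi_boundP.
  by rewrite divr_ge0 // divr_ge0 // ltW.
have [k [Kk k2 Nk Mk]] : exists k, [/\ K < k, 2 < k, N <= k & M <= k]%N.
  by exists (N + K + M + 3)%N; clear; split; lia.
have {}hC := hC k Kk k2.
have /andP[_ hk] := hN k Nk.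
have k0 : 0 < k%:R :> R by rewrite ltr0n (ltn_trans _ k2).
have Ck : C / k%:R <= eps / 2.
  rewrite ler_pdivrMr //; apply: (le_trans (ler_norm C)).
  by rewrite mulrC -ler_pdivrMr ?divr_gt0 //; apply: (le_trans hM); rewrite ler_nat.
have : Phi beta / beta <= ln2 / beta - e k + eps / 2.
  rewrite ler_pdivrMr // 2!mulrDl divfK ?gt_eqF //; lra.
lra.
Unshelve. all: by end_near.
Qed.
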